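(* There exist absolute constants $c,d>0$ such that the following holds for every finite-precision Lanczos run of $k$ completed iterations (for arbitrary $n$, symmetric $A\in\mathbb{R}^{n\times n}$, nonzero $v\in\mathbb{R}^n$, $k_{\max}$, $k\le k_{\max}$ and $0\le\varepsilon\le 1/(20k_{\max})$, as defined in the context). Put $N=nk$. There exist symmetric matrices $S,\widetilde T\in\mathbb{R}^{N\times N}$ such that (i) $\widetilde T$ is tridiagonal and its leading $k\times k$ principal block is exactly the computed $T_k$; (ii) $S=\widehat U^{\mathsf T}(I_k\otimes A)\widehat U$ for an orthogonal matrix $\widehat U\in\mathbb{R}^{N\times N}$ satisfying $\widehat Ue_1=\operatorname{col}\bigl(v_1/\|v_1\|,0,\ldots,0\bigr)$ (the vector in $\mathbb{R}^{nk}$ obtained by stacking $v_1/\|v_1\|\in\mathbb{R}^n$ and $k-1$ zero vectors of $\mathbb{R}^n$); (iii) $\|S-\widetilde T\|\le c\,k^d\,\varepsilon\|A\|$. Consequently, exact $k$-step Lanczos applied to $(\widetilde T,e_1)$ returns the computed matrix $T_k$ exactly.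
   Context: Norms are Euclidean for vectors and spectral for matrices; $e_j$ denotes a standard basis vector; $I_k\otimes A$ is the block-diagonal matrix with $k$ copies of $A$. Finite-precision Lanczos run. Let $n,k_{\max}\ge1$ be integers, $A\in\mathbb{R}^{n\times n}$ symmetric, $v\in\mathbb{R}^n$ nonzero, and let the accuracy parameter satisfy $0\le\varepsilon\le 1/(20k_{\max})$. A run of $k$ completed iterations ($1\le k\le k_{\max}$) of the finite-precision symmetric Lanczos algorithm without reorthogonalization on $(A,v)$ consists of real vectors $v_j,u_j,w_j,z_j\in\mathbb{R}^n$ and real scalars $\alpha_j,\beta_j$ such that: $v_0=0$, $\beta_0=0$; $v_1$ satisfies $|v_1^{\mathsf T}v_1-1|\le\varepsilon$ and $\beta v_1=v+\Delta_0$ for some $\beta>0$ and some $\Delta_0$ with $\|\Delta_0\|\le\varepsilon\|v\|$; and for $j=1,\dots,k$ there are errors with $$u_j=Av_j+e^u_j,\quad \|e^u_j\|\le\varepsilon\|A\|\|v_j\|;$$ $$w_j=u_j-\beta_{j-1}v_{j-1}+e^w_j,\quad \|e^w_j\|\le\varepsilon(\|u_j\|+\beta_{j-1}\|v_{j-1}\|);$$ $$\alpha_j=v_j^{\mathsf T}w_j+e^\alpha_j,\quad |e^\alpha_j|\le\varepsilon\|v_j\|\|w_j\|;$$ $$z_j=w_j-\alpha_jv_j+e^z_j,\quad \|e^z_j\|\le\varepsilon(\|w_j\|+|\alpha_j|\|v_j\|).$$ If $z_j\ne0$ then $\beta_j>0$, $\beta_jv_{j+1}=z_j+\Delta_j$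 with $\|\Delta_j\|\le\varepsilon\|z_j\|$, and $|v_{j+1}^{\mathsf T}v_{j+1}-1|\le\varepsilon$. If $z_j=0$ then $\beta_j=0$ and the algorithm terminates. Termination can occur only at $j=k$, so $\beta_1,\dots,\beta_{k-1}>0$. If the run terminates at step $k$, $v_{k+1}$ is not formed and by convention $\Delta_k=0$ and $\beta_kv_{k+1}=0$. $T_k\in\mathbb{R}^{k\times k}$ is the symmetric tridiagonal matrix with diagonal $\alpha_1,\dots,\alpha_k$ and off-diagonal entries $\beta_1,\dots,\beta_{k-1}$. Exact $k$-step Lanczos on a symmetric matrix $B$ and nonzero vector $b$: the same procedure with no errors, i.e. $q_0=0$, $b_0=0$, $q_1=b/\|b\|$, and for $j=1,2,\dots,k$: $w=Bq_j-b_{j-1}q_{j-1}$, $a_j=q_j^{\mathsf T}w$, $z=w-a_jq_j$, $b_j=\|z\|$, and $q_{j+1}=z/b_j$ if $b_j>0$ (stop if $b_j=0$). It returns the symmetric tridiagonal matrix with diagonal $a_1,\dots,a_k$ and off-diagonal $b_1,\dots,b_{k-1}$. *)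

(* Defs.v *)
From HB Require Import structures.
From mathcomp Require Import all_boot all_order all_algebra.
From mathcomp Require Import mxtens.
From mathcomp Require Import classical_sets reals exp.
Set Implicit Arguments.
Unset Strict Implicit.
Unset Printing Implicit Defensive.
Import Order.TTheory GRing.Theory Num.Theory.
Local Open Scope ring_scope.

(* The norm that MathComp-Analysis puts on matrices is the max norm. *)
Definition enorm (R : realType) (n : nat) (x : 'cV[R]_n) : R :=
  Num.sqrt (\sum_i x i 0 ^+ 2).

Definition specnorm (R : realType) (m n : nat) (A : 'M[R]_(m, n)) : R :=
  sup [set r : R | exists2 x : 'cV[R]_n, enorm x <= 1 & r = enorm (A *m x)].

Definition dotv (R : realType) (n : nat) (x y : 'cV[R]_n) : R :=
  (x^T *m y) 0 0.

Definition basis1 (R : realType) (n : nat) : 'cV[R]_n :=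
  \col_i ((i == 0 :> nat)%:R).

(* Row p of the stacked column is row p %% n of block p %/ n, the same block
   layout as that of the Kronecker product tensmx. *)
Definition stack_col (R : realType) (k n : nat) (F : 'I_k -> 'cV[R]_n) :
    'cV[R]_(k * n) :=
  \col_p F (mxtens_unindex p).1 (mxtens_unindex p).2 0.

Definition is_tridiag (R : realType) (n : nat) (M : 'M[R]_n) : Prop :=
  forall i j : 'I_n, (i.+1 < j)%N || (j.+1 < i)%N -> M i j = 0.

(* Diagonal a 0, ..., a m.-1 and off-diagonal b 0, ..., b m.-2. *)
Definition symtridiag (R : realType) (m : nat) (a b : nat -> R) : 'M[R]_m :=
  \matrix_(i, j)
    if i == j then a i
    else if j == i.+1 :> nat then b i
    else if i == j.+1 :> nat then b j
    else 0.

Definition leading_block (R : realType) (k m : nat) (le_km : (k <= m)%N)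
    (M : 'M[R]_m) : 'M[R]_k :=
  mxsub (widen_ord le_km) (widen_ord le_km) M.

(* The sequences are functions on nat of which only the entries
     v 0, ..., v k.+1, u 1, ..., u k (likewise w, z),
     alpha 1, ..., alpha k, beta 0, ..., beta k
   are constrained; when z k = 0 the vector v k.+1 is unconstrained. *)
Record fp_lanczos_run (R : realType) (n : nat) (A : 'M[R]_n) (x : 'cV[R]_n)
    (eps : R) (k : nat) (v u w z : nat -> 'cV[R]_n) (alpha beta : nat -> R) :
    Prop := FpLanczosRun {
  fp_v0 : v 0%N = 0;
  fp_beta0 : beta 0%N = 0;
  fp_v1_unit : `|dotv (v 1%N) (v 1%N) - 1| <= eps;
  fp_v1 : exists2 b : R, 0 < b &
    exists2 Delta0 : 'cV[R]_n,
      b *: v 1%N = x + Delta0 & enorm Delta0 <= eps * enorm x;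
  fp_u : forall j : nat, (1 <= j <= k)%N ->
    exists2 e : 'cV[R]_n, u j = A *m v j + e &
      enorm e <= eps * specnorm A * enorm (v j);
  fp_w : forall j : nat, (1 <= j <= k)%N ->
    exists2 e : 'cV[R]_n, w j = u j - beta j.-1 *: v j.-1 + e &
      enorm e <= eps * (enorm (u j) + beta j.-1 * enorm (v j.-1));
  fp_alpha : forall j : nat, (1 <= j <= k)%N ->
    exists2 e : R, alpha j = dotv (v j) (w j) + e &
      `|e| <= eps * enorm (v j) * enorm (w j);
  fp_z : forall j : nat, (1 <= j <= k)%N ->
    exists2 e : 'cV[R]_n, z j = w j - alpha j *: v j + e &
      enorm e <= eps * (enorm (w j) + `|alpha j| * enorm (v j));
  fp_next : forall j : nat, (1 <= j <= k)%N -> z j != 0 ->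
    [/\ 0 < beta j,
        exists2 Delta : 'cV[R]_n, beta j *: v j.+1 = z j + Delta &
          enorm Delta <= eps * enorm (z j)
      & `|dotv (v j.+1) (v j.+1) - 1| <= eps];
  fp_stop : forall j : nat, (1 <= j <= k)%N -> z j = 0 -> beta j = 0;
  fp_no_early_stop : forall j : nat, (1 <= j < k)%N -> z j != 0
}.

(* The pairs (a_j, b_j) computed by at most fuel further steps of exact Lanczos
   from the state (q_(j-1), b_(j-1), q_j). *)
Fixpoint exact_lanczos_steps (R : realType) (m : nat) (B : 'M[R]_m)
    (fuel : nat) (qprev : 'cV[R]_m) (bprev : R) (q : 'cV[R]_m) :
    seq (R * R) :=
  if fuel is fuel'.+1 then
    let w := B *m q - bprev *: qprev in
    let a := dotv q w in
    let z := w - a *: q in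
    let b := enorm z in
    (a, b) :: (if b == 0 then [::]
               else exact_lanczos_steps B fuel' q b (b^-1 *: z))
  else [::].

(* The dimension of the returned matrix is the number of completed steps, which
   is smaller than k when some b_j vanishes with j < k. *)
Definition exact_lanczos (R : realType) (m : nat) (B : 'M[R]_m) (b : 'cV[R]_m)
    (k : nat) : {p : nat & 'M[R]_p} :=
  let s := exact_lanczos_steps B k 0 0 ((enorm b)^-1 *: b) in
  existT (fun p : nat => 'M[R]_p) (size s)
    (symtridiag (size s) (fun i => (nth (0, 0) s i).1)
                         (fun i => (nth (0, 0) s i).2)).

(* Main.v *)
(* Let V have the normalized computed vectors v_1, ..., v_(k+1) as columns,
   V^T V = 1 + U + U^T with U strictly upper triangular, M = (1 + U)^-1 and
   S = 1 - M. Then (V M)^T (V M) = 1 - S^T S, so the blocks V M S^i telescope: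
   since S is nilpotent, the first k columns of the stack of V M S^i, i < k,
   form an orthonormal family Q starting with v_1 / |v_1| in block 0.
   The computed recurrence A V = V T + D and the local orthogonality
   beta_j v_j^T v_(j+1) = O(eps) show that T almost commutes with U, hence with M
   and S; therefore (1 (x) A) Q = Q T_k + r e_k^T + O(eps) with Q^T r = 0.
   Complete Q to an orthogonal matrix whose remaining columns tridiagonalize
   the compression of 1 (x) A, starting from the direction of r; dropping the
   O(eps) terms gives the tridiagonal extension of T_k. *)
Require Import Defs.
From mathcomp Require Import all_boot all_order all_algebra.
From mathcomp Require Import mxtens.
From mathcomp Require Import classical_sets reals exp.
From mathcomp Require Import ring lra zify.
Import Order.TTheory GRing.Theory Num.Theory.
Set Implicit Arguments.
Unset Strict Implicit.
Unset Printing Implicit Defensive.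
Local Open Scope ring_scope.

(** * Frobenius, Euclidean and spectral norms *)

(** The computed vectors may lose orthogonality completely, so [U] need not be small and a direct
    estimate of the inverse of [1 + U] would grow exponentially with k. The identity for [V M]
    removes this obstacle: whatever the size of [U], it makes both [S] and [V M] contractions, so
    powers of [S] cost nothing and [M = 1 - S] has Frobenius norm at most 2 sqrt(k+1). Smallness
    enters through the commutator of [T] with the Gram matrix, which equals [V^T D - D^T V] because
    A is symmetric; its strictly upper part is that of [T U - U T]. There is no recurrence for A
    v_(k+1), hence no control of the last column of [D]. All estimates are therefore made on the
    first k columns, which upper triangular factors on the right respect. The Frobenius norm is used
    because it dominates the spectral norm, is invariant under orthogonal factors, and adds up over
    entries and blocks. The final constant is a product: 32 k eps |A| for the error of one column,
    where k comes from the growth of beta_j, times 64 k^4 for the passage to the stacked isometry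
    and its completion. *)

Definition fnorm (R : realType) (m n : nat) (X : 'M[R]_(m, n)) : R :=
  Num.sqrt (\sum_i \sum_j X i j ^+ 2).

Lemma cauchy_schwarz_sum (R : realType) (I : finType) (f g : I -> R) :
  (\sum_i f i * g i) ^+ 2 <= (\sum_i f i ^+ 2) * (\sum_i g i ^+ 2).
Proof.
set F := \sum_i f i ^+ 2; set G := \sum_i g i ^+ 2; set H := \sum_i f i * g i.
have G_ge0 : 0 <= G by apply: sumr_ge0 => i _; exact: sqr_ge0.
have [G0|G_neq0] := eqVneq G 0.
  have g0 i : g i = 0.
    have /eqP := G0; rewrite psumr_eq0 => [|j _]; last exact: sqr_ge0.
    by move=> /allP /(_ i (mem_index_enum i)); rewrite sqrf_eq0 => /eqP.
  by rewrite /H big1 ?expr0n ?G0 ?mulr0 // => i _; rewrite g0 mulr0.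
have : 0 <= \sum_i (G * f i - H * g i) ^+ 2.
  by apply: sumr_ge0 => i _; exact: sqr_ge0.
have -> : \sum_i (G * f i - H * g i) ^+ 2 = G * (F * G - H ^+ 2).
  suff expand a b : \sum_i (a * f i - b * g i) ^+ 2 =
      a ^+ 2 * F - 2 * a * b * H + b ^+ 2 * G by rewrite expand; ring.
  rewrite /F /G /H !mulr_sumr -sumrB -big_split /=.
  by apply: eq_bigr => i _; ring.
by rewrite pmulr_rge0 ?subr_ge0 // lt_neqAle eq_sym G_neq0.
Qed.

Lemma fnorm_ge0 (R : realType) (m n : nat) (X : 'M[R]_(m, n)) : 0 <= fnorm X.
Proof. exact: sqrtr_ge0. Qed.

Lemma fnorm_sqr (R : realType) (m n : nat) (X : 'M[R]_(m, n)) :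
  fnorm X ^+ 2 = \sum_i \sum_j X i j ^+ 2.
Proof.
by rewrite sqr_sqrtr //; do 2!apply: sumr_ge0 => ? _; exact: sqr_ge0.
Qed.

Lemma fnorm_sqr_tr (R : realType) (m n : nat) (X : 'M[R]_(m, n)) :
  fnorm X ^+ 2 = \tr (X^T *m X).
Proof.
rewrite fnorm_sqr exchange_big /=; apply: eq_bigr => j _.
by rewrite mxE; apply: eq_bigr => i _; rewrite !mxE expr2.
Qed.

Lemma fnorm_tr (R : realType) (m n : nat) (X : 'M[R]_(m, n)) :
  fnorm X^T = fnorm X.
Proof.
congr Num.sqrt; rewrite exchange_big /=.
by apply: eq_bigr => i _; apply: eq_bigr => j _; rewrite mxE.
Qed.

Lemma fnorm_leP (R : realType) (m n : nat) (X : 'M[R]_(m, n)) (e : R) :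
  0 <= e -> (fnorm X <= e) = (\sum_i \sum_j X i j ^+ 2 <= e ^+ 2).
Proof. by move=> e0; rewrite -fnorm_sqr ler_pXn2r ?nnegrE ?fnorm_ge0. Qed.

Lemma fnorm_cV (R : realType) (n : nat) (x : 'cV[R]_n) : fnorm x = enorm x.
Proof. by congr Num.sqrt; apply: eq_bigr => i _; rewrite big_ord1. Qed.

Lemma fnorm_colE (R : realType) (m n : nat) (X : 'M[R]_(m, n)) :
  fnorm X ^+ 2 = \sum_j enorm (col j X) ^+ 2.
Proof.
rewrite fnorm_sqr exchange_big /=; apply: eq_bigr => j _.
rewrite -fnorm_cV fnorm_sqr; apply: eq_bigr => i _.
by rewrite big_ord1 mxE.
Qed.

Lemma fnorm_dot (R : realType) (m n : nat) (X Y : 'M[R]_(m, n)) :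
  `|\sum_i \sum_j X i j * Y i j| <= fnorm X * fnorm Y.
Proof.
rewrite -(@ler_pXn2r _ 2) ?nnegrE ?mulr_ge0 ?fnorm_ge0 //.
rewrite exprMn !fnorm_sqr -normrX ger0_norm ?sqr_ge0 // !pair_bigA /=.
exact: (@cauchy_schwarz_sum _ _ (fun p => X p.1 p.2) (fun p => Y p.1 p.2)).
Qed.

Lemma ler_fnormD (R : realType) (m n : nat) (X Y : 'M[R]_(m, n)) :
  fnorm (X + Y) <= fnorm X + fnorm Y.
Proof.
rewrite fnorm_leP ?addr_ge0 ?fnorm_ge0 // sqrrD !fnorm_sqr.
have -> : \sum_i \sum_j (X + Y) i j ^+ 2 = \sum_i \sum_j X i j ^+ 2 +
    (\sum_i \sum_j X i j * Y i j) *+ 2 + \sum_i \sum_j Y i j ^+ 2.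
  rewrite -sumrMnl -!big_split /=; apply: eq_bigr => i _.
  rewrite -sumrMnl -!big_split /=; apply: eq_bigr => j _.
  by rewrite mxE sqrrD.
rewrite lerD2r lerD2l lerMn2r /=.
exact: le_trans (ler_norm _) (fnorm_dot _ _).
Qed.

Lemma fnorm0 (R : realType) (m n : nat) : fnorm (0 : 'M[R]_(m, n)) = 0.
Proof.
rewrite /fnorm big1 ?sqrtr0 // => i _.
by rewrite big1 // => j _; rewrite mxE expr0n.
Qed.

Lemma fnormZ (R : realType) (m n : nat) (a : R) (X : 'M[R]_(m, n)) :
  fnorm (a *: X) = `|a| * fnorm X.
Proof.
apply/eqP; rewrite -(@eqrXn2 _ 2) ?mulr_ge0 ?fnorm_ge0 //; apply/eqP.
rewrite exprMn -normrX ger0_norm ?sqr_ge0 // !fnorm_sqr mulr_sumr.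
apply: eq_bigr => i _; rewrite mulr_sumr; apply: eq_bigr => j _.
by rewrite mxE exprMn.
Qed.

Lemma fnormN (R : realType) (m n : nat) (X : 'M[R]_(m, n)) :
  fnorm (- X) = fnorm X.
Proof. by rewrite -scaleN1r fnormZ normrN normr1 mul1r. Qed.

Lemma ler_fnormB (R : realType) (m n : nat) (X Y : 'M[R]_(m, n)) :
  fnorm (X - Y) <= fnorm X + fnorm Y.
Proof. by rewrite -(fnormN Y) ler_fnormD. Qed.

Lemma ler_fnormM (R : realType) (m n p : nat) (X : 'M[R]_(m, n))
    (Y : 'M[R]_(n, p)) : fnorm (X *m Y) <= fnorm X * fnorm Y.
Proof.
rewrite fnorm_leP ?mulr_ge0 ?fnorm_ge0 // exprMn !fnorm_sqr mulr_suml.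
apply: ler_sum => i _; rewrite [X in _ * X]exchange_big mulr_sumr /=.
by apply: ler_sum => j _; rewrite mxE; exact: cauchy_schwarz_sum.
Qed.

Lemma fnorm_orthoM (R : realType) (m n p : nat) (O : 'M[R]_(m, n))
    (X : 'M[R]_(n, p)) : O^T *m O = 1%:M -> fnorm (O *m X) = fnorm X.
Proof.
move=> OO; apply/eqP; rewrite -(@eqrXn2 _ 2) ?fnorm_ge0 //; apply/eqP.
by rewrite !fnorm_sqr_tr trmx_mul -mulmxA (mulmxA O^T) OO mul1mx.
Qed.

Lemma enorm_ge0 (R : realType) (n : nat) (x : 'cV[R]_n) : 0 <= enorm x.
Proof. exact: sqrtr_ge0. Qed.

Lemma enorm_sqr (R : realType) (n : nat) (x : 'cV[R]_n) :
  enorm x ^+ 2 = dotv x x.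
Proof. by rewrite -fnorm_cV fnorm_sqr_tr /mxtrace big_ord1. Qed.

Lemma enorm_eq0 (R : realType) (n : nat) (x : 'cV[R]_n) :
  (enorm x == 0) = (x == 0).
Proof.
apply/eqP/eqP => [x0|->]; last by rewrite -fnorm_cV fnorm0.
have: \sum_i x i 0 ^+ 2 == 0.
  rewrite -[X in X == _]sqr_sqrtr ?[Num.sqrt _]x0 ?expr0n //.
  by apply: sumr_ge0 => i _; exact: sqr_ge0.
rewrite psumr_eq0 => [/allP x20|i _]; last exact: sqr_ge0.
apply/colP => i; rewrite mxE.
by have := x20 i (mem_index_enum i); rewrite sqrf_eq0 => /eqP.
Qed.

Lemma enormZ (R : realType) (n : nat) (a : R) (x : 'cV[R]_n) :
  enorm (a *: x) = `|a| * enorm x.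
Proof. by rewrite -!fnorm_cV fnormZ. Qed.

Lemma enormN (R : realType) (n : nat) (x : 'cV[R]_n) : enorm (- x) = enorm x.
Proof. by rewrite -!fnorm_cV fnormN. Qed.

Lemma ler_enormD (R : realType) (n : nat) (x y : 'cV[R]_n) :
  enorm (x + y) <= enorm x + enorm y.
Proof. by rewrite -!fnorm_cV ler_fnormD. Qed.

Lemma ler_dotv (R : realType) (n : nat) (x y : 'cV[R]_n) :
  `|dotv x y| <= enorm x * enorm y.
Proof.
rewrite -!fnorm_cV; apply: le_trans (fnorm_dot _ _); rewrite /dotv mxE.
by under eq_bigr do rewrite mxE; under [in leRHS]eq_bigr do rewrite big_ord1.
Qed.

Lemma ler_enorm_fnorm (R : realType) (m n : nat) (A : 'M[R]_(m, n))
    (x : 'cV[R]_n) : enorm x <= 1 -> enorm (A *m x) <= fnorm A.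
Proof.
move=> x1; rewrite -fnorm_cV; apply: le_trans (ler_fnormM _ _) _.
by rewrite ler_piMr ?fnorm_ge0 // fnorm_cV.
Qed.

Lemma enorm_le_specnorm (R : realType) (m n : nat) (A : 'M[R]_(m, n))
    (x : 'cV[R]_n) : enorm x <= 1 -> enorm (A *m x) <= specnorm A.
Proof.
move=> x1; apply: ub_le_sup; last by exists x.
by exists (fnorm A) => _ [y y1 ->]; exact: ler_enorm_fnorm.
Qed.

Lemma specnorm_ge0 (R : realType) (m n : nat) (A : 'M[R]_(m, n)) :
  0 <= specnorm A.
Proof.
apply: le_trans (enorm_le_specnorm A (x := 0) _); first exact: enorm_ge0.
by rewrite -fnorm_cV fnorm0.
Qed.

Lemma specnorm_le_fnorm (R : realType) (m n : nat) (A : 'M[R]_(m, n)) :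
  specnorm A <= fnorm A.
Proof.
apply: ge_sup => [|_ [x x1 ->]]; last exact: ler_enorm_fnorm.
by exists (enorm (A *m 0)), 0 => //; rewrite -fnorm_cV fnorm0.
Qed.

Lemma ler_enorm_specnorm (R : realType) (m n : nat) (A : 'M[R]_(m, n))
    (x : 'cV[R]_n) : enorm (A *m x) <= specnorm A * enorm x.
Proof.
have [->|x0] := eqVneq x 0; first by rewrite mulmx0 -!fnorm_cV !fnorm0 mulr0.
have x_gt0 : 0 < enorm x by rewrite lt_neqAle eq_sym enorm_eq0 x0 enorm_ge0.
rewrite -ler_pdivrMr // mulrC -[(enorm x)^-1]ger0_norm ?invr_ge0 ?enorm_ge0 //.
rewrite -enormZ scalemxAr enorm_le_specnorm // enormZ.
by rewrite ger0_norm ?invr_ge0 ?enorm_ge0 // mulVf ?gt_eqF.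
Qed.

(** * Loss of orthogonality and the Lanczos recurrence *)

(** Support on or above the i-th superdiagonal: index 0 means upper triangular, index 1 strictly so.
    The index adds up under products, which gives nilpotency and the vanishing of the first i
    columns of an i-th power. *)
Definition upshift (R : realType) (n i : nat) (X : 'M[R]_n) : Prop :=
  forall a b : 'I_n, (b < a + i)%N -> X a b = 0.

Lemma upshiftW (R : realType) (n i j : nat) (X : 'M[R]_n) :
  (i <= j)%N -> upshift j X -> upshift i X.
Proof. by move=> ij Xj a b ab; apply: Xj; lia. Qed.

Lemma upshift1 (R : realType) (n : nat) : upshift 0 (1%:M : 'M[R]_n).
Proof. by move=> a b ab; rewrite mxE; case: eqVneq ab => [->|//]; lia. Qed.

Lemma upshiftN (R : realType) (n i : nat) (X : 'M[R]_n) :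
  upshift i X -> upshift i (- X).
Proof. by move=> Xi a b ab; rewrite mxE Xi ?oppr0. Qed.

Lemma upshiftM (R : realType) (n i j : nat) (X Y : 'M[R]_n) :
  upshift i X -> upshift j Y -> upshift (i + j) (X *m Y).
Proof.
move=> Xi Yj a b ab; rewrite mxE big1 // => c _.
have [ac|ac] := ltnP c (a + i); first by rewrite Xi // mul0r.
by rewrite Yj ?mulr0 //; lia.
Qed.

Lemma upshiftX (R : realType) (n i : nat) (X : 'M[R]_n.+1) :
  upshift 1 X -> upshift i (X ^+ i).
Proof.
move=> X1; elim: i => [|i IHi]; first by rewrite expr0; exact: upshift1.
by rewrite exprS; apply: (upshiftM X1 IHi).
Qed.

Lemma upshift_eq0 (R : realType) (n i : nat) (X : 'M[R]_n) :
  (n <= i)%N -> upshift i X -> X = 0.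
Proof.
move=> ni Xi; apply/matrixP => a b; rewrite mxE Xi //.
by have := ltn_ord b; lia.
Qed.

(** The Neumann series of [- U] is finite by nilpotency, and [1 - M = U M] inherits strictness from
    [U]. *)
Lemma unitriangular_inverse (R : realType) (n : nat) (U : 'M[R]_n.+1) :
  upshift 1 U -> exists M : 'M[R]_n.+1,
    [/\ (1 + U) * M = 1, M * (1 + U) = 1, upshift 0 M & upshift 1 (1 - M)].
Proof.
move=> U1; pose M := \sum_(i < n.+1) (- U) ^+ i.
have NM : (1 + U) * M = 1.
  have := subrX1 (- U) n.+1; rewrite -/M.
  have -> : (- U) ^+ n.+1 = 0.
    by apply: (@upshift_eq0 _ _ n.+1) => //; apply/upshiftX/upshiftN.
  rewrite sub0r => /(congr1 -%R); rewrite opprK -mulNr opprB opprK => <-.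
  by [].
have M0 : upshift 0 M.
  move=> a b ab; rewrite summxE big1 // => i _.
  by rewrite (upshiftX (i := i) (upshiftN U1)) //; lia.
exists M; split=> //; first by apply: mulmx1C.
have -> : 1 - M = U * M by rewrite -[X in X - _]NM mulrDl mul1r addrC addKr.
exact: (upshiftM U1 M0).
Qed.

(* Paige's identity: the strictly upper triangular S = 1 - M = U M measures the
   loss of orthogonality, and stacking S on V M restores orthonormality. *)
Lemma paige_isometry (R : realType) (n : nat) (U M : 'M[R]_n.+1) :
  (1 + U) * M = 1 ->
  M^T *m (1 + U + U^T) *m M = 1 - (1 - M)^T *m (1 - M).
Proof.
(* With N = 1 + U the middle factor is N + N^T - 1, so the conjugate collapses to M^T + M - M^T
   M. *)
move=> NM; have -> : 1 + U + U^T = (1 + U) + (1 + U)^T - 1.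
  by rewrite [(1 + U)^T]linearD /= trmx1 addrA addrAC addrK.
move: (1 + U) NM => N NM.
have {}NM : N *m M = 1%:M := NM.
have MN : M^T *m N^T = 1%:M by rewrite -trmx_mul NM trmx1.
rewrite mulmxBr mulmxDr MN mulmxBl mulmxDl -(mulmxA M^T N) NM.
rewrite [(1 - M)^T]linearB /= trmx1 mulmxBl !mulmxBr !mul1mx !mulmx1.
by apply/matrixP => i j; rewrite !mxE; ring.
Qed.

(** The hypothesis says that stacking [S] on [W] gives an isometry: the squared norms of [S X] and
    [W X] add up to that of [X]. *)
Lemma ler_fnorm_contraction (R : realType) (n m k p : nat) (S : 'M[R]_k)
    (W : 'M[R]_(n, k)) (X : 'M[R]_(k, p)) :
  W^T *m W = 1%:M - S^T *m S -> fnorm (S *m X) <= fnorm X /\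
                               fnorm (W *m X) <= fnorm X.
Proof.
move=> WW.
suff SWX : fnorm (S *m X) ^+ 2 + fnorm (W *m X) ^+ 2 = fnorm X ^+ 2.
  by split; rewrite -(@ler_pXn2r _ 2) ?nnegrE ?fnorm_ge0 // -SWX
    (lerDl, lerDr) sqr_ge0.
rewrite !fnorm_sqr_tr !trmx_mul -!mulmxA (mulmxA S^T) (mulmxA W^T) -raddfD /=.
by rewrite -mulmxDr WW -mulmxDl addrC subrK mul1mx.
Qed.

Lemma fnorm_scalar1 (R : realType) (n : nat) :
  fnorm (1%:M : 'M[R]_n) = Num.sqrt n%:R.
Proof.
congr Num.sqrt; rewrite -[n in RHS]card_ord -sum1_card natr_sum.
apply: eq_bigr => i _; rewrite (bigD1 i) //= big1 => [|j ji]; rewrite mxE.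
  by rewrite eqxx expr1n addr0.
by rewrite eq_sym (negbTE ji) expr0n.
Qed.

Lemma ler_fnorm_entries (R : realType) (m n : nat) (X : 'M[R]_(m, n)) (e : R) :
  0 <= e -> (forall i j, `|X i j| <= e) -> fnorm X ^+ 2 <= m%:R * n%:R * e ^+ 2.
Proof.
move=> e0 Xe; rewrite fnorm_sqr -[m in leRHS]card_ord -[n in leRHS]card_ord.
rewrite -!sum1_card !natr_sum mulr_suml mulr_suml; apply: ler_sum => i _.
rewrite mul1r mulr_suml; apply: ler_sum => j _.
by rewrite mul1r -real_normK ?num_real // ler_pXn2r ?nnegrE.
Qed.

(** Multiplying the strictly lower triangular [U^T] by a tridiagonal matrix yields nothing above the
    diagonal, so there the commutator with the whole Gram matrix sees only [U]. On the diagonal a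
    single product of neighbouring entries survives in each of the two terms; this is where local
    orthogonality is needed. *)
Lemma tridiag_commutator (R : realType) (n : nat) (T U : 'M[R]_n) (delta : R) :
  0 <= delta -> T^T = T -> is_tridiag T -> upshift 1 U ->
  (forall i j : 'I_n, j = i.+1 :> nat -> `|T i j * U i j| <= delta) ->
  let G := T *m U - U *m T in
  [/\ forall a b : 'I_n, (b < a)%N -> G a b = 0,
      forall a : 'I_n, `|G a a| <= 2 * delta
    & forall a b : 'I_n, (a < b)%N ->
        G a b = (T *m (1%:M + U + U^T) - (1%:M + U + U^T) *m T) a b].
Proof.
move=> d0 Tsym Ttri U1 TU G.
have Tsw i j : T i j = T j i by rewrite -{1}Tsym mxE.
have GE a b : G a b = \sum_c T a c * U c b - \sum_c U a c * T c b.
  by rewrite /G !mxE.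
have Ut i j : U^T i j = U j i by rewrite mxE.
split=> [a b ba|a|a b ab].
- rewrite GE !big1 ?subrr // => c _.
    have [ca|ac] := ltnP a c; last by rewrite U1 ?mul0r //; lia.
    by rewrite [T c b]Ttri ?mulr0 //; lia.
  have [cb|bc] := ltnP c b; last by rewrite U1 ?mulr0 //; lia.
  by rewrite Ttri ?mul0r //; lia.
- have sum1 (F : 'I_n -> R) (P : pred 'I_n) : (forall i j, P i -> P j -> i = j) ->
      (forall c, ~~ P c -> F c = 0) -> (forall c, P c -> `|F c| <= delta) ->
      `|\sum_c F c| <= delta.
    move=> P1 F0 FP; have [c Pc|noP] := pickP P.
      rewrite (bigD1 c) //= big1 ?addr0 ?FP // => j jc; apply: F0.
      by apply: contra_neqN jc => Pj; exact: P1.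
    by rewrite big1 ?normr0 // => c _; rewrite F0 ?noP.
  rewrite GE; apply: le_trans (ler_normB _ _) _; rewrite mulr2n mulrDl mul1r.
  apply: lerD.
    apply: (sum1 _ (fun c => c.+1 == a :> nat)) => [i j /eqP ia /eqP ja|c ca|c /eqP ca].
    + by apply: ord_inj; lia.
    + have [|ac] := ltnP c a; first by move=> ac; rewrite Ttri ?mul0r //; lia.
      by rewrite U1 ?mulr0 //; lia.
    + by rewrite Tsw TU.
  apply: (sum1 _ (fun c => c == a.+1 :> nat)) => [i j /eqP ia /eqP ja|c ca|c /eqP ca].
  + by apply: ord_inj; lia.
  + have [ac|ac] := ltnP a c; last by rewrite U1 ?mul0r //; lia.
    by rewrite [T c a]Ttri ?mulr0 //; lia.
  + by rewrite mulrC [T c a]Tsw TU.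
- rewrite !mulmxDr !mulmxDl mulmx1 mul1mx.
  set X := T *m U^T; set Y := U^T *m T.
  have -> : T + T *m U + X - (T + U *m T + Y) = G + (X - Y).
    by apply/matrixP => i j; rewrite /G !mxE; ring.
  have X0 : X a b = 0.
    rewrite mxE big1 // => c _; rewrite Ut; have [bc|cb] := ltnP b c.
      by rewrite Ttri ?mul0r //; lia.
    by rewrite U1 ?mulr0 //; lia.
  have Y0 : Y a b = 0.
    rewrite mxE big1 // => c _; rewrite Ut; have [ca|ac] := ltnP c a.
      by rewrite [T c b]Ttri ?mulr0 //; lia.
    by rewrite U1 ?mul0r //; lia.
  by rewrite [RHS]mxE [(X - Y) a b]mxE [(- Y) a b]mxE X0 Y0 subrr addr0.
Qed.

(** Right multiplication by this matrix keeps the first k columns, those on which the recurrence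
    residual is under control. *)
Definition leadcols (R : realType) (k : nat) : 'M[R]_(k.+1, k) :=
  colsub (widen_ord (leqnSn k)) 1%:M.

Lemma mulmx_leadcols (R : realType) (m k : nat) (X : 'M[R]_(m, k.+1)) a b :
  (X *m leadcols R k) a b = X a (widen_ord (leqnSn k) b).
Proof. by rewrite mulmx_colsub mulmx1 mxE. Qed.

Lemma ler_fnorm_leadcols (R : realType) (m k : nat) (X : 'M[R]_(m, k.+1)) :
  fnorm (X *m leadcols R k) <= fnorm X.
Proof.
rewrite -(@ler_pXn2r _ 2) ?nnegrE ?fnorm_ge0 // !fnorm_sqr.
apply: ler_sum => i _; rewrite big_ord_recr /=.
under eq_bigr do rewrite mulmx_leadcols.
by rewrite lerDl sqr_ge0.
Qed.

(** An upper triangular matrix leaves the span of the first k basis vectors invariant; [X'] is its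
    leading block. A bound on the leading columns of some [Y] thus survives multiplication by [X] on
    the right. *)
Lemma upshift0_leadcols (R : realType) (k : nat) (X : 'M[R]_k.+1) :
  upshift 0 X -> exists2 X' : 'M[R]_k,
    X *m leadcols R k = leadcols R k *m X' & fnorm X' <= fnorm X.
Proof.
move=> X0; exists ((leadcols R k)^T *m X *m leadcols R k); last first.
  apply: le_trans (ler_fnorm_leadcols _) _.
  by rewrite -fnorm_tr trmx_mul trmxK -(fnorm_tr X) ler_fnorm_leadcols.
set f := widen_ord (leqnSn k).
apply/matrixP => a b; rewrite mulmx_leadcols.
have [ak|ka] := ltnP a k.
  have -> : a = f (Ordinal ak) by apply: val_inj.
  rewrite mxE (bigD1 (Ordinal ak)) //= big1 => [|c ca].
    rewrite mxE mxE -/f eqxx mul1r addr0 mulmx_leadcols -[_ *m X]trmxK.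
    by rewrite trmx_mul trmxK mxE mulmx_leadcols mxE.
  rewrite mxE mxE (_ : _ == _ = false) ?mul0r //.
  by apply: contra_neqF ca => /eqP fa; apply: val_inj; have := congr1 val fa.
rewrite X0 /=; last by have := ltn_ord b; lia.
rewrite mxE big1 // => c _; rewrite mxE mxE (_ : _ == _ = false) ?mul0r //.
by apply/negP => /eqP /(congr1 val) /= ac; have := ltn_ord c; lia.
Qed.

Lemma ler_fnorm_mul_leadcols (R : realType) (m k : nat) (Y : 'M[R]_(m, k.+1))
    (X : 'M[R]_k.+1) : upshift 0 X ->
  fnorm (Y *m X *m leadcols R k) <= fnorm (Y *m leadcols R k) * fnorm X.
Proof.
move=> X0; have [X' XX' X'X] := upshift0_leadcols X0.
rewrite -mulmxA XX' mulmxA; apply: le_trans (ler_fnormM _ _) _.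
by rewrite ler_wpM2l ?fnorm_ge0.
Qed.

(** By symmetry of [A], the commutator of [T] with [V^T V] is [V^T D - D^T V]. An entry (a, b) with
    a < b < k involves only columns a and b of [D], both bounded by [delta]; the remaining factor
    counts entries. *)
Lemma gram_commutator_bound (R : realType) (n k : nat) (A : 'M[R]_n)
    (V : 'M[R]_(n, k.+1)) (T U : 'M[R]_k.+1) (delta : R) :
  0 <= delta -> A^T = A -> T^T = T -> is_tridiag T ->
  upshift 1 U -> V^T *m V = 1%:M + U + U^T ->
  (forall j : 'I_k.+1, (j < k)%N ->
    enorm (col j (A *m V - V *m T)) <= delta) ->
  (forall i j : 'I_k.+1, j = i.+1 :> nat -> `|T i j * U i j| <= delta) ->
  fnorm ((T *m U - U *m T) *m leadcols R k) <= 2 * delta * k.+1%:R.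
Proof.
move=> d0 Asym Tsym Ttri U1 VV VD TU.
have [G0 Gd Gu] := tridiag_commutator d0 Tsym Ttri U1 TU.
move: (T *m U - U *m T) G0 Gd Gu => G G0 Gd Gu.
set D := A *m V - V *m T in VD.
have V1 j : enorm (col j V) = 1.
  apply/eqP; rewrite -(@eqrXn2 _ 2) ?enorm_ge0 // expr1n enorm_sqr; apply/eqP.
  transitivity ((V^T *m V) j j).
    by rewrite /dotv !mxE; apply: eq_bigr => i _; rewrite !mxE.
  rewrite VV !mxE eqxx (U1 j j) ?addr0 //; lia.
have comm : T *m (V^T *m V) - (V^T *m V) *m T = V^T *m D - D^T *m V.
  rewrite /D [(_ - _)^T]linearB /= !trmx_mul Asym Tsym mulmxBr mulmxBl !mulmxA.
  by apply/matrixP => i j; rewrite !mxE; ring.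
have dotE (X Y : 'M[R]_(n, k.+1)) a b :
    (X^T *m Y) a b = dotv (col a X) (col b Y).
  by rewrite /dotv !mxE; apply: eq_bigr => i _; rewrite !mxE.
rewrite -(@ler_pXn2r _ 2) ?nnegrE ?mulr_ge0 ?fnorm_ge0 //.
have Gbound (i : 'I_k.+1) (j : 'I_k) : `|(G *m leadcols R k) i j| <= 2 * delta.
  rewrite mulmx_leadcols; set b := widen_ord _ j.
  have bk : (b < k)%N := ltn_ord j.
  have [ab|ba|ab] := ltngtP i b.
  - rewrite Gu // -VV comm mxE [X in _ + X]mxE !dotE.
    apply: le_trans (ler_normB _ _) _; rewrite mulr2n mulrDl mul1r.
    apply: lerD; apply: le_trans (ler_dotv _ _) _.
      by rewrite V1 mul1r VD.
    by rewrite V1 mulr1 VD //; lia.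
  - by rewrite G0 // normr0 mulr_ge0.
  - by rewrite (ord_inj ab) Gd.
apply: le_trans (ler_fnorm_entries (mulr_ge0 _ d0) Gbound) _ => //.
rewrite [leRHS]exprMn mulrC ler_wpM2l ?sqr_ge0 // [leRHS]expr2 ler_wpM2l //.
by rewrite ler_nat.
Qed.

(* The witness is Y i = V M S^i. Columns of S^i vanish up to index i, which is
   why only the first k columns are kept and only k blocks are needed, and why
   column 0 lives in block 0. *)
Lemma lanczos_isometry (R : realType) (n k : nat) (A : 'M[R]_n)
    (V : 'M[R]_(n, k.+1)) (T : 'M[R]_k.+1) (delta : R) :
  A^T = A -> T^T = T -> is_tridiag T -> 0 <= delta ->
  (forall j : 'I_k.+1, enorm (col j V) = 1) ->
  (forall j : 'I_k.+1, (j < k)%N ->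
    enorm (col j (A *m V - V *m T)) <= delta) ->
  (forall i j : 'I_k.+1, j = i.+1 :> nat ->
    `|T i j * dotv (col i V) (col j V)| <= delta) ->
  exists Y : nat -> 'M[R]_(n, k.+1),
    [/\ forall i, fnorm ((A *m Y i - Y i *m T) *m leadcols R k) <=
          (8 * i.+1)%:R * k.+1%:R ^+ 2 * delta,
        (leadcols R k)^T *m (\sum_(i < k) (Y i)^T *m Y i) = (leadcols R k)^T,
        col 0 (Y 0%N) = col 0 V
      & forall i, (0 < i)%N -> col 0 (Y i) = 0].
Proof.
move=> Asym Tsym Ttri d0 V1 VD TV.
have [U UE] : exists U : 'M[R]_k.+1, forall i j,
    U i j = if (i < j)%N then (V^T *m V) i j else 0.
  by exists (\matrix_(i, j) if (i < j)%N then (V^T *m V) i j else 0) => i j;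
    rewrite mxE.
have dotE a b : (V^T *m V) a b = dotv (col a V) (col b V).
  by rewrite /dotv !mxE; apply: eq_bigr => i _; rewrite !mxE.
have U1 : upshift 1 U by move=> a b ab; rewrite UE ifF //; lia.
have VV : V^T *m V = 1 + U + U^T.
  apply/matrixP => a b.
  have -> : (1 + U + U^T) a b = (a == b)%:R + U a b + U b a by rewrite !mxE.
  rewrite !UE; have [ab|ba|ab] := ltngtP a b.
  - by rewrite -val_eqE /= ltn_eqF // add0r addr0.
  - rewrite -val_eqE /= gtn_eqF // !add0r !mxE.
    by apply: eq_bigr => i _; rewrite !mxE mulrC.
  - by rewrite (ord_inj ab) eqxx !addr0 dotE -enorm_sqr V1 expr1n.
have TU (i j : 'I_k.+1) : j = i.+1 :> nat -> `|T i j * U i j| <= delta.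
  by move=> ij; rewrite UE ij leqnn dotE TV.
have Gle := gram_commutator_bound d0 Asym Tsym Ttri U1 VV VD TU.
have [M [NM MN M0 S1]] := unitriangular_inverse U1.
set S := 1 - M in S1; set G := _ - _ in Gle; set L := leadcols R k in Gle *.
set s := Num.sqrt (k.+1%:R : R).
have ss : s * s = k.+1%:R by rewrite -expr2 sqr_sqrtr.
have s0 : 0 <= s := sqrtr_ge0 _.
have WW : (V *m M)^T *m (V *m M) = 1%:M - S^T *m S.
  by rewrite trmx_mul -(paige_isometry NM) -VV !mulmxA.
have Sle p (X : 'M[R]_(_, p)) := (@ler_fnorm_contraction R n 0 _ p _ _ X WW).1.
have Wle p (X : 'M[R]_(_, p)) := (@ler_fnorm_contraction R n 0 _ p _ _ X WW).2.
have SX i : fnorm (S ^+ i) <= s.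
  elim: i => [|i IHi]; first by rewrite expr0 fnorm_scalar1.
  by rewrite exprS; apply: le_trans IHi; exact: Sle.
have SXle i p (X : 'M[R]_(_, p)) : fnorm (S ^+ i *m X) <= fnorm X.
  elim: i X => [|i IHi] X; first by rewrite expr0 mul1mx.
  by rewrite exprSr -mulmxA; apply: le_trans (IHi _) (Sle _ _).
have ME : M = 1 - S by rewrite /S opprB addrC subrK.
(* A difference of two consecutive powers of the contraction [S], hence bounded independently of
   i. *)
have MSX i : fnorm (M *m S ^+ i) <= 2 * s.
  have -> : M *m S ^+ i = S ^+ i - S ^+ i.+1.
    by rewrite ME -[_ *m _]/(_ * _) mulrBl mul1r exprS.
  apply: le_trans (ler_fnormB _ _) _; rewrite mulr2n mulrDl mul1r.
  by apply: lerD; exact: SX.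
have Mle : fnorm M <= 2 * s by have := MSX 0%N; rewrite expr0 mulmx1.
have up_MSX i : upshift 0 (M *m S ^+ i).
  by apply: (upshiftM (j := 0) M0); apply: (upshiftW (leq0n i)); exact: upshiftX.
(* Conjugating the commutator by the inverse of [1 + U] turns [G] into the commutator of [M] with
   [T], which up to sign is that of [S] with [T]. *)
pose H := M *m G *m M.
have TM : T *m M = M *m T - H.
  have HE : H = M *m T - T *m M.
    rewrite /H /G.
    have -> : T *m U - U *m T = T *m (1 + U) - (1 + U) *m T.
      rewrite mulmxDr mulmxDl mulmx1 mul1mx.
      by apply/matrixP => i j; rewrite !mxE; ring.
    rewrite mulmxBr mulmxBl -!mulmxA [(1 + U) *m M]NM mulmx1.
    by rewrite !mulmxA [M *m (1 + U)]MN mul1mx.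
  by rewrite HE opprB addrC subrK.
have TS : T *m S = S *m T + H.
  rewrite /S mulmxBr mulmxBl mulmx1 mul1mx TM.
  by apply/matrixP => i j; rewrite !mxE; ring.
pose Y i := V *m M *m S ^+ i.
pose Res i := A *m Y i - Y i *m T.
set D := A *m V - V *m T in VD.
have AV : A *m V = V *m T + D by rewrite addrC subrK.
clearbody D.
have Dle : fnorm (D *m L) <= delta * s.
  rewrite -(@ler_pXn2r _ 2) ?nnegrE ?mulr_ge0 ?fnorm_ge0 // exprMn.
  rewrite fnorm_colE sqr_sqrtr //.
  apply: (@le_trans _ _ (\sum_(j < k) delta ^+ 2)); last first.
    by rewrite sumr_const card_ord -[leLHS]mulr_natr ler_wpM2l ?sqr_ge0 // ler_nat.
  apply: ler_sum => j _; rewrite ler_pXn2r ?nnegrE ?enorm_ge0 //.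
  have -> : col j (D *m L) = col (widen_ord (leqnSn k) j) D.
    by apply/colP => i; rewrite [RHS]mxE [LHS]mxE mulmx_leadcols.
  exact: (VD (widen_ord (leqnSn k) j) (ltn_ord j)).
have GMS q : fnorm (G *m (M *m S ^+ q) *m L) <= 2 * delta * k.+1%:R * (2 * s).
  apply: le_trans (ler_fnorm_mul_leadcols _ (up_MSX q)) _.
  by rewrite ler_pM ?fnorm_ge0.
pose g := k.+1%:R ^+ 2 * delta.
have g0 : 0 <= g by rewrite mulr_ge0 ?sqr_ge0.
(* Since [Res i.+1 = Res i *m S + Y i *m H], the statement carries a free power [S ^+ q] that
   absorbs the extra [S]. Each step then adds at most [8 * g], so the bound grows linearly in i
   instead of picking up a factor |S| every time. *)
have Res_le i q : fnorm (Res i *m S ^+ q *m L) <= (8 * i.+1)%:R * g.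
  elim: i q => [|i IHi] q.
    have -> : Res 0%N = D *m M - V *m M *m G *m M.
      have -> : V *m M *m G *m M = V *m H by rewrite /H !mulmxA.
      rewrite /Res /Y expr0 mulmx1 mulmxA AV mulmxDl -!(mulmxA V) TM mulmxBr.
      move: (D *m M) (V *m (M *m T)) (V *m H) => x y z.
      by apply/matrixP => a b; rewrite !mxE; ring.
    rewrite !mulmxBl; apply: le_trans (ler_fnormB _ _) _.
    have le1 : fnorm (D *m M *m S ^+ q *m L) <= 2 * g.
      rewrite -(mulmxA D); apply: le_trans (ler_fnorm_mul_leadcols _ (up_MSX q)) _.
      apply: le_trans (ler_pM _ _ Dle (MSX q)) _; rewrite ?fnorm_ge0 //.
      have -> : delta * s * (2 * s) = 2 * (k.+1%:R * delta) by rewrite -ss; ring.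
      rewrite ler_wpM2l // ler_wpM2r // expr2 ler_peMl //.
      by rewrite ler1n.
    have le2 : fnorm (V *m M *m G *m M *m S ^+ q *m L) <= 4 * g.
      have -> : V *m M *m G *m M *m S ^+ q *m L =
          V *m M *m (G *m (M *m S ^+ q) *m L) by rewrite !mulmxA.
      apply: le_trans (Wle _ _) _; apply: le_trans (GMS q) _.
      have -> : 2 * delta * k.+1%:R * (2 * s) = 4 * (k.+1%:R * s * delta) by ring.
      rewrite ler_wpM2l // ler_wpM2r // expr2 ler_wpM2l // -ss.
      by rewrite ler_peMl // -sqrtr1 ler_wsqrtr // ler1n.
    by rewrite muln1; lra.
  have -> : Res i.+1 *m S ^+ q = Res i *m S ^+ q.+1 + Y i *m H *m S ^+ q.
    have -> : Res i.+1 = Res i *m S + Y i *m H.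
      have YS : Y i.+1 = Y i *m S by rewrite /Y exprSr -[_ * S]/(_ *m S) mulmxA.
      rewrite /Res YS mulmxBl -!(mulmxA (Y i)) (mulmxA A) TS (mulmxDr (Y i)).
      by rewrite opprD addrA subrK.
    by rewrite mulmxDl -(mulmxA (Res i)) -[S *m _]/(_ * _) -exprS.
  rewrite mulmxDl; apply: le_trans (ler_fnormD _ _) _.
  have le3 : fnorm (Y i *m H *m S ^+ q *m L) <= 8 * g.
    have -> : Y i *m H *m S ^+ q *m L =
        V *m M *m (S ^+ i *m (M *m (G *m (M *m S ^+ q) *m L))).
      by rewrite /H /Y !mulmxA.
    apply: le_trans (Wle _ _) _; apply: le_trans (SXle _ _ _) _.
    apply: le_trans (ler_fnormM _ _) _.
    apply: le_trans (ler_pM _ _ Mle (GMS q)) _; rewrite ?fnorm_ge0 //.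
    by rewrite /g expr2 -{2}ss le_eqVlt; apply/orP; left; apply/eqP; ring.
  by have := IHi q.+1; rewrite !natrM -[i.+2]addn1 natrD; lra.
have sumY p : \sum_(i < p) (Y i)^T *m Y i = 1%:M - (S ^+ p)^T *m S ^+ p.
  elim: p => [|p IHp]; first by rewrite big_ord0 expr0 trmx1 mulmx1 subrr.
  have YY : (Y p)^T *m Y p = (S ^+ p)^T *m ((V *m M)^T *m (V *m M)) *m S ^+ p.
    by rewrite /Y [(_ *m S ^+ p)^T]trmx_mul !mulmxA.
  rewrite big_ord_recr /= IHp YY WW mulmxBr mulmx1 mulmxBl addrA subrK.
  by congr (_ - _); rewrite exprS -[S * _]/(S *m _) trmx_mul !mulmxA.
have S0 i : (0 < i)%N -> col 0 (S ^+ i) = 0.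
  move=> i0; apply/colP => a; rewrite !mxE.
  by rewrite (upshiftX (i := i) S1) //=; lia.
exists Y; split=> [i|||i i_gt0].
- by have := Res_le i 0%N; rewrite expr0 mulmx1 /g mulrA.
- rewrite sumY mulmxBr mulmx1 mulmxA -trmx_mul.
  rewrite (_ : S ^+ k *m L = 0) ?trmx0 ?mul0mx ?subr0 //.
  apply/matrixP => a b; rewrite mulmx_leadcols (upshiftX (i := k) S1) ?mxE //=.
  by have := ltn_ord b; lia.
- rewrite /Y expr0 mulmx1 !colE ME mulmxBr mulmx1 mulmxBl -mulmxA -(colE _ S).
  by have := S0 1%N; rewrite expr1 => ->; rewrite ?mulmx0 ?subr0.
- by rewrite /Y colE -mulmxA -colE S0 ?mulmx0.
Qed.

(** * Orthonormal completion and tridiagonalization *)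

(** The reflection along u = g - |g| e_1. It moves g to |g| e_1 because u^T u = 2 u^T g; when u = 0
    the identity does the job. *)
Lemma householder (R : realType) (n : nat) (g : 'cV[R]_n.+1) :
  exists2 O : 'M[R]_n.+1, O^T *m O = 1%:M & O *m g = enorm g *: delta_mx 0 0.
Proof.
set rho := enorm g; pose e : 'cV[R]_n.+1 := delta_mx 0 0.
pose u := g - rho *: e; pose s := dotv u u.
have [u0|u_neq0] := eqVneq u 0.
  exists 1%:M; first by rewrite trmx1 mulmx1.
  by rewrite mul1mx; apply/eqP; rewrite -subr_eq0 -/u u0.
have s_neq0 : s != 0 by rewrite /s -enorm_sqr sqrf_eq0 enorm_eq0.
have uuE : u^T *m u = s%:M by rewrite [LHS]mx11_scalar.
exists (1%:M - (2 / s) *: (u *m u^T)).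
  rewrite [(_ - _)^T]linearB /= [(_ *: _)^T]linearZ /= trmx_mul trmxK trmx1.
  rewrite mulmxBl mul1mx mulmxBr mulmx1 -scalemxAl -scalemxAr scalerA.
  rewrite -mulmxA (mulmxA u^T) uuE mul_scalar_mx -scalemxAr scalerA.
  move: (u *m u^T) => X; apply/matrixP => i j; rewrite !mxE.
  by move: (_ *+ _) (X i j) => x y; field.
have g2 : g^T *m g = (rho ^+ 2)%:M by rewrite enorm_sqr [LHS]mx11_scalar.
have eg : e^T *m g = (g 0 0)%:M.
  rewrite [LHS]mx11_scalar; congr _%:M; rewrite mxE (bigD1 0) //= big1.
    by rewrite !mxE !eqxx mul1r addr0.
  by move=> i i0; rewrite !mxE (negbTE i0) mul0r.
have ee : e^T *m e = 1%:M.
  rewrite [LHS]mx11_scalar; congr _%:M; rewrite mxE (bigD1 0) //= big1.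
    by rewrite !mxE !eqxx mul1r addr0.
  by move=> i i0; rewrite !mxE (negbTE i0) mul0r.
have ge : g^T *m e = (g 0 0)%:M by rewrite -[LHS]trmxK trmx_mul trmxK eg tr_scalar_mx.
have ug : u^T *m g = (rho ^+ 2 - rho * g 0 0)%:M.
  rewrite /u [(_ - _)^T]linearB /= [(_ *: _)^T]linearZ /= mulmxBl -scalemxAl g2 eg.
  by rewrite scale_scalar_mx -raddfB.
have sE : s = 2 * (rho ^+ 2 - rho * g 0 0).
  rewrite /s /dotv {2}/u mulmxBr -scalemxAr ug /u.
  rewrite [(_ - _)^T]linearB /= [(_ *: _)^T]linearZ /= mulmxBl.
  rewrite -scalemxAl ge ee !mxE eqxx /= !mulr1n; ring.
rewrite mulmxBl mul1mx -scalemxAl -mulmxA ug mul_mx_scalar scalerA.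
have -> : 2 / s * (rho ^+ 2 - rho * g 0 0) = 1.
  by rewrite mulrAC -sE divff.
by rewrite scale1r /u opprB addrC subrK.
Qed.

Lemma block_ortho (R : realType) (n : nat) (O : 'M[R]_n) :
  O^T *m O = 1%:M ->
  (block_mx 1%:M 0 0 O : 'M[R]_(1 + n))^T *m block_mx 1%:M 0 0 O = 1%:M.
Proof.
move=> OO; rewrite tr_block_mx mulmx_block !trmx0 trmx1 OO.
by rewrite !mul0mx !mulmx0 !mulmx1 !addr0 add0r -scalar_mx_block.
Qed.

Lemma mulmx_ortho (R : realType) (n : nat) (O O' : 'M[R]_n) :
  O^T *m O = 1%:M -> O'^T *m O' = 1%:M -> (O *m O')^T *m (O *m O') = 1%:M.
Proof. by move=> OO OO'; rewrite trmx_mul -mulmxA (mulmxA O^T) OO mul1mx. Qed.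

(** The vector [g] is both what the application needs and what drives the induction: once [g] is
    aligned with e_1, the part of the first column of [C1] below the diagonal becomes the vector to
    be aligned for the trailing block. *)
Lemma tridiagonalization (R : realType) (m : nat) (C : 'M[R]_m)
    (g : 'cV[R]_m) : C^T = C ->
  exists O : 'M[R]_m, [/\ O^T *m O = 1%:M, is_tridiag (O *m C *m O^T)
    & forall i : 'I_m, (0 < i)%N -> (O *m g) i 0 = 0].
Proof.
elim: m C g => [|m IHm] C g Csym.
  by exists 1%:M; split=> [||[]//]; [rewrite trmx1 mulmx1 | move=> []].
have [O1 OO1 O1g] := householder g.
pose C1 : 'M[R]_(1 + m) := O1 *m C *m O1^T.
have C1sym : C1^T = C1 by rewrite /C1 !trmx_mul trmxK Csym mulmxA.
have C1E : C1 = block_mx (ulsubmx C1) (dlsubmx C1)^T (dlsubmx C1) (drsubmx C1).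
  by rewrite trmx_dlsub C1sym submxK.
have [|O2 [OO2 O2tri O2g]] := IHm (drsubmx C1) (dlsubmx C1).
  by rewrite trmx_drsub C1sym.
pose P : 'M[R]_(1 + m) := block_mx 1%:M 0 0 O2.
have PC1P : P *m C1 *m P^T = block_mx (ulsubmx C1) (O2 *m dlsubmx C1)^T
    (O2 *m dlsubmx C1) (O2 *m drsubmx C1 *m O2^T).
  rewrite {1}C1E /P tr_block_mx !mulmx_block !trmx0 trmx1 !mul0mx !mulmx0.
  by rewrite !mulmx1 !mul1mx !addr0 !add0r trmx_mul ?mul0mx ?addr0.
have PC1Ptri : @is_tridiag R (1 + m) (P *m C1 *m P^T).
  rewrite PC1P => i j; rewrite -[i]splitK -[j]splitK.
  case: split => i'; case: split => j' /=; rewrite ?ord1 //=.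
  - by rewrite block_mxEur mxE orbF => lt1j; apply: O2g; lia.
  - by rewrite block_mxEdl => lt1i; apply: O2g; lia.
  - by rewrite block_mxEdr => ltij; apply: O2tri; lia.
have Pe : P *m col_mx 1%:M 0 = col_mx 1%:M 0 :> 'cV[R]_(1 + m).
  by rewrite mul_block_col !mul0mx mulmx0 !addr0 mul1mx.
have eE : delta_mx 0 0 = col_mx 1%:M 0 :> 'cV[R]_(1 + m).
  apply/colP => i; rewrite -[i]splitK.
  by case: split => i' /=; rewrite ?col_mxEu ?col_mxEd !mxE ?ord1 ?eqxx.
exists (P *m O1); split.
- by apply: mulmx_ortho => //; exact: block_ortho.
- suff -> : P *m O1 *m C *m (P *m O1)^T = P *m C1 *m P^T by [].
  by rewrite trmx_mul /C1 !mulmxA.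
- move=> i i_gt0; rewrite -mulmxA O1g eE -scalemxAr Pe -eE !mxE.
  by rewrite (_ : (i == 0) = false) ?mulr0 //; case: i i_gt0 => -[].
Qed.

(** Householder QR; orthonormal columns force the triangular factor to be the identity. *)
Lemma orthonormal_reduction (R : realType) (k m : nat) (Q : 'M[R]_(k + m, k)) :
  Q^T *m Q = 1%:M ->
  exists2 O : 'M[R]_(k + m), O^T *m O = 1%:M & O *m Q = col_mx 1%:M 0.
Proof.
elim: k Q => [|k IHk] Q QQ.
  exists 1%:M; first by rewrite trmx1 mulmx1.
  by apply/matrixP => i [].
pose q : 'cV[R]_(k + m).+1 := @lsubmx _ _ 1 k Q.
have [O1 OO1 O1q] := householder q.
have q1 : enorm q = 1.
  apply/eqP; rewrite -(@eqrXn2 _ 2) ?enorm_ge0 // expr1n enorm_sqr; apply/eqP.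
  have := congr1 (fun X : 'M_(1 + k) => X 0 0) QQ.
  rewrite [RHS]mxE eqxx mulr1n mxE => <-.
  rewrite /dotv mxE; apply: eq_bigr => i _; rewrite !mxE.
  by congr (Q _ _ * Q _ _); apply: val_inj.
rewrite {}q1 scale1r in O1q.
pose Q1 : 'M[R]_(1 + (k + m), 1 + k) := O1 *m Q.
have Q1Q1 : Q1^T *m Q1 = 1%:M.
  by rewrite trmx_mul -mulmxA (mulmxA O1^T) OO1 mul1mx.
have lQ1 : lsubmx Q1 = col_mx 1%:M 0.
  rewrite /Q1 -mulmx_lsub O1q; apply/colP => j; rewrite -[j]splitK.
  by case: split => j' /=; rewrite ?col_mxEu ?col_mxEd !mxE ?ord1 ?eqxx.
have Q1E : Q1 = block_mx 1%:M (usubmx (rsubmx Q1)) 0 (dsubmx (rsubmx Q1)).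
  by rewrite block_mxEh vsubmxK -lQ1 hsubmxK.
move: (usubmx _) (dsubmx _) Q1E => ur dr Q1E.
move: Q1Q1; rewrite Q1E tr_block_mx mulmx_block !trmx0 trmx1.
rewrite !mul0mx !mulmx0 !mul1mx !mulmx1 !addr0 [1%:M in RHS]scalar_mx_block.
(* The first column is already e_1, so orthogonality to it annihilates the rest of the first row. *)
case/eq_block_mx => _ ur0 _; rewrite {}ur0 mulmx0 add0r in Q1E * => drQ1.
have [O2 OO2 O2Q] := IHk _ drQ1.
pose P : 'M[R]_(1 + (k + m)) := block_mx 1%:M 0 0 O2.
exists (P *m O1); first by apply: mulmx_ortho => //; exact: block_ortho.
have PQ1 : P *m Q1 = block_mx 1%:M 0 0 (col_mx 1%:M 0).
  rewrite Q1E mulmx_block !mul0mx !mulmx0 !mul1mx !addr0 !add0r O2Q.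
  by [].
suff -> : P *m O1 *m Q = P *m Q1.
  rewrite PQ1; apply/matrixP => i j.
  have -> : (block_mx 1%:M 0 0 (col_mx 1%:M 0) : 'M[R]_(1 + (k + m), 1 + k)) i j
      = (i == j :> nat)%:R.
    rewrite -[i in LHS](splitK (i : 'I_(1 + (k + m)))).
    rewrite -[j in LHS](splitK (j : 'I_(1 + k))).
    case: splitP => i' iE; case: splitP => j' jE /=.
    - by rewrite block_mxEul mxE iE jE.
    - by rewrite block_mxEur mxE iE jE ord1.
    - by rewrite block_mxEdl mxE iE jE ord1.
    - rewrite block_mxEdr -[i']splitK iE jE eqn_add2l.
      case: splitP => l lE /=; rewrite ?col_mxEu ?col_mxEd !mxE ?lE //.
      by rewrite (_ : (_ == _) = false) //; apply/eqP; have := ltn_ord j'; lia.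
  rewrite -[i]splitK; case: split => l /=; rewrite ?col_mxEu ?col_mxEd mxE //.
  by rewrite (_ : (_ == _) = false) //; apply/eqP; have := ltn_ord j; lia.
by rewrite /Q1 mulmxA.
Qed.

Lemma orthonormal_completion (R : realType) (k m : nat)
    (Q : 'M[R]_(k + m, k)) : Q^T *m Q = 1%:M ->
  exists W : 'M[R]_(k + m, m), (row_mx Q W)^T *m row_mx Q W = 1%:M.
Proof.
move=> QQ; have [O OO OQ] := orthonormal_reduction QQ.
exists (O^T *m col_mx 0 1%:M).
have -> : row_mx Q (O^T *m col_mx 0 1%:M) = O^T.
  have {1}-> : Q = O^T *m col_mx 1%:M 0 by rewrite -OQ mulmxA OO mul1mx.
  by rewrite -mul_mx_row -block_mxEh -scalar_mx_block mulmx1.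
by rewrite trmxK; apply: mulmx1C.
Qed.

Lemma fnorm_row_mx (R : realType) (m n p : nat) (X : 'M[R]_(m, n))
    (Y : 'M[R]_(m, p)) : fnorm (row_mx X Y) ^+ 2 = fnorm X ^+ 2 + fnorm Y ^+ 2.
Proof.
rewrite !fnorm_sqr -big_split /=; apply: eq_bigr => i _.
rewrite big_split_ord /=; congr (_ + _); apply: eq_bigr => j _.
  by rewrite row_mxEl.
by rewrite row_mxEr.
Qed.

Lemma fnorm_col_mx (R : realType) (m n p : nat) (X : 'M[R]_(m, p))
    (Y : 'M[R]_(n, p)) : fnorm (col_mx X Y) ^+ 2 = fnorm X ^+ 2 + fnorm Y ^+ 2.
Proof. by rewrite -fnorm_tr tr_col_mx fnorm_row_mx !fnorm_tr. Qed.

(** The basis of the complement is chosen so that [W^T r] is a multiple of e_1; the coupling block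
    [Y] then has only its top right entry, exactly where a tridiagonal matrix allows one. The
    trailing block is copied unchanged from [B], so the error sits in the first columns and their
    mirror image: its squared norm is at most twice that of [E], within the stated factor 2. *)
Lemma tridiag_completion (R : realType) (k m : nat) (B : 'M[R]_(k.+1 + m))
    (Q E : 'M[R]_(k.+1 + m, k.+1)) (T : 'M[R]_k.+1) (r : 'cV[R]_(k.+1 + m)) :
  B^T = B -> T^T = T -> is_tridiag T -> Q^T *m Q = 1%:M -> Q^T *m r = 0 ->
  B *m Q = Q *m T + r *m delta_mx 0 ord_max + E ->
  exists (W : 'M[R]_(k.+1 + m, m)) (Tt : 'M[R]_(k.+1 + m)),
    let U := row_mx Q W in
    [/\ U^T *m U = 1%:M, Tt^T = Tt, is_tridiag Tt, ulsubmx Tt = T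
      & fnorm (U^T *m B *m U - Tt) <= 2 * fnorm E].
Proof.
move=> Bsym Tsym Ttri QQ Qr BQ.
have [W0 W0U] := orthonormal_completion QQ.
have [QW0 W0Q W0W0] : [/\ Q^T *m W0 = 0, W0^T *m Q = 0 & W0^T *m W0 = 1%:M].
  move: W0U; rewrite tr_row_mx mul_col_row scalar_mx_block.
  by case/eq_block_mx.
have [|O [OO Otri Og]] := @tridiagonalization _ _ (W0^T *m B *m W0) (W0^T *m r).
  by rewrite !trmx_mul trmxK Bsym mulmxA.
have OO' : O *m O^T = 1%:M by apply: mulmx1C.
pose W := W0 *m O^T; pose e : 'rV[R]_k.+1 := delta_mx 0 ord_max.
have WQ : W^T *m Q = 0 by rewrite trmx_mul trmxK -mulmxA W0Q mulmx0.
have QW : Q^T *m W = 0 by rewrite mulmxA QW0 mul0mx.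
have WW : W^T *m W = 1%:M.
  by rewrite trmx_mul trmxK -mulmxA (mulmxA W0^T) W0W0 mul1mx.
have WrE : W^T *m r = O *m (W0^T *m r) by rewrite trmx_mul trmxK mulmxA.
have WBW : W^T *m B *m W = O *m (W0^T *m B *m W0) *m O^T.
  by rewrite /W trmx_mul trmxK !mulmxA.
move: W WQ QW WW WrE WBW => W WQ QW WW WrE WBW.
pose Y := W^T *m r *m e; pose C := W^T *m B *m W.
pose Tt := block_mx T Y^T Y C; exists W, Tt => U.
have Csym : C^T = C by rewrite /C !trmx_mul trmxK Bsym mulmxA.
have UU : U^T *m U = 1%:M.
  by rewrite tr_row_mx mul_col_row QQ QW WQ WW -scalar_mx_block.
have YE i j : Y i j = (O *m (W0^T *m r)) i 0 * (j == ord_max)%:R.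
  rewrite /Y WrE mxE big_ord1; congr (_ * _).
  by rewrite mxE eqxx.
split=> //.
- by rewrite /Tt tr_block_mx trmxK Tsym Csym.
- have Y0 (i : 'I_m) (j : 'I_k.+1) : (0 < i)%N || (j < k)%N -> Y i j = 0.
    rewrite YE; case/orP => [i_gt0|jk]; first by rewrite Og // mul0r.
    by rewrite -val_eqE (ltn_eqF jk) mulr0.
  rewrite /Tt => i j; rewrite -[i]splitK -[j]splitK.
  case: split => i'; case: split => j' /=.
  + by rewrite block_mxEul; apply: Ttri.
  + rewrite block_mxEur mxE => /= ij; apply: Y0.
    by have := ltn_ord i'; lia.
  + rewrite block_mxEdl => /= ij; apply: Y0.
    by have := ltn_ord j'; lia.
  + by rewrite block_mxEdr /C WBW => ij; apply: Otri; lia.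
- by rewrite /Tt block_mxKul.
have WBQ : W^T *m B *m Q = Y + W^T *m E.
  by rewrite -mulmxA BQ !mulmxDr mulmxA WQ mul0mx add0r mulmxA.
have QBW : Q^T *m B *m W = Y^T + (W^T *m E)^T.
  by rewrite -linearD /= -WBQ !trmx_mul trmxK Bsym mulmxA.
have QBQ : Q^T *m B *m Q = T + Q^T *m E.
  by rewrite -mulmxA BQ !mulmxDr mulmxA QQ mul1mx (mulmxA _ r) Qr mul0mx addr0.
have -> : U^T *m B *m U - Tt = row_mx (U^T *m E) (col_mx (W^T *m E)^T 0).
  rewrite /U tr_row_mx mul_col_mx mul_col_row QBQ QBW WBQ -/C.
  rewrite opp_block_mx add_block_mx subrr.
  rewrite ![_ + _ *m E - _]addrAC ![_ + _^T - _]addrAC !subrr !add0r.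
  by rewrite mul_col_mx block_mxEh.
have UE : fnorm (U^T *m E) = fnorm E.
  by apply: fnorm_orthoM; rewrite trmxK; apply: mulmx1C.
rewrite -(@ler_pXn2r _ 2) ?nnegrE ?mulr_ge0 ?fnorm_ge0 //.
rewrite fnorm_row_mx fnorm_col_mx fnorm_tr fnorm0 UE.
have := fnorm_col_mx (Q^T *m E) (W^T *m E).
rewrite -mul_col_mx -tr_row_mx -/U UE.
have := sqr_ge0 (fnorm (Q^T *m E)); have := sqr_ge0 (fnorm E).
rewrite expr0n exprMn /=; lra.
Qed.

(** * Exact Lanczos on a tridiagonal matrix *)

Definition basisv (R : realType) (n j : nat) : 'cV[R]_n :=
  \col_i ((i == j :> nat)%:R).

Lemma enorm_basisv (R : realType) (n j : nat) :
  (j < n)%N -> enorm (basisv R n j) = 1.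
Proof.
move=> jn; rewrite /enorm (bigD1 (Ordinal jn)) //= big1 => [|i ij].
  by rewrite mxE eqxx expr1n addr0 sqrtr1.
by rewrite mxE (_ : (i == j :> nat) = false) ?expr0n //; exact: negbTE.
Qed.

(** The invariant is q_j = e_j. It constrains only the product [bprev *: qprev], so that the start
    with zero vector fits. Positive off-diagonal entries exclude an early stop and make the
    normalization return +e_(j+1). *)
Lemma exact_lanczos_steps_tridiag (R : realType) (m k : nat) (B : 'M[R]_m)
    (a b : nat -> R) : (k <= m)%N -> B^T = B -> is_tridiag B ->
  (forall i : 'I_m, (i < k)%N -> B i i = a i) ->
  (forall i j : 'I_m, i = j.+1 :> nat -> (i < k)%N -> B i j = b j) ->
  (forall i, (i.+1 < k)%N -> 0 < b i) ->
  forall f j qprev bprev, (j + f = k)%N ->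
  bprev *: qprev = (if j is j'.+1 then b j' *: basisv R m j' else 0) ->
  let s := exact_lanczos_steps B f qprev bprev (basisv R m j) in
  [/\ size s = f, forall i, (i < f)%N -> (nth (0, 0) s i).1 = a (j + i)%N
    & forall i, (i.+1 < f)%N -> (nth (0, 0) s i).2 = b (j + i)%N].
Proof.
move=> km Bsym Btri Bd Bo b_gt0; elim=> [//|f IHf] j qprev bprev jf prevE /=.
have jk : (j < k)%N by lia.
have jm : (j < m)%N by lia.
pose jo := Ordinal jm.
have BjE i : (B *m basisv R m j) i 0 = B i jo.
  rewrite mxE (bigD1 jo) //= big1 => [|l lj]; rewrite !mxE /=.
    by rewrite eqxx mulr1 addr0.
  by rewrite (_ : (l == j :> nat) = false) ?mulr0 //; exact: negbTE.
have Bsw i l : B i l = B l i by rewrite -{1}Bsym mxE.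
set w := B *m _ - _.
have prevv i : (bprev *: qprev) i 0 =
    if j is j'.+1 then b j' * (i == j' :> nat)%:R else 0.
  by rewrite prevE; case: (j) => [|j']; rewrite !mxE.
have wE i : w i 0 = if i == jo then a j
                    else if i == j.+1 :> nat then B i jo else 0.
  have -> : w i 0 = (B *m basisv R m j) i 0 - (bprev *: qprev) i 0.
    by rewrite /w mxE [X in _ + X]mxE.
  rewrite BjE prevv; have [->|ij] := eqVneq i jo.
    rewrite Bd //=; case: (j) => [|j']; first by rewrite subr0.
    by rewrite (_ : (_ == _) = false) ?mulr0 ?subr0 //; lia.
  case: eqVneq => [ij1|ij1].
    case: (j) ij1 => [|j'] ij1; first by rewrite subr0.
    by rewrite (_ : (_ == _) = false) ?mulr0 ?subr0 //; lia.
  have {}ij : (i : nat) != j by [].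
  have [ij'|ij'] := ltnP j i.
    rewrite Btri; last by apply/orP; right => /=; lia.
    case: (j) ij' => [|j'] ij'; first by rewrite subr0.
    by rewrite (_ : (_ == _) = false) ?mulr0 ?subr0 //; lia.
  case: (j) (jo) (erefl : jo = j :> nat) ij ij' jk => [|j'] jo' ijo.
    by move=> ? ?; lia.
  move=> ij ij' jk'; case: eqVneq => [ij2|ij2].
    by rewrite Bsw (Bo jo' i) ?ij2 ?mulr1 ?subrr //; lia.
  by rewrite Btri ?mulr0 ?subr0 //; apply/orP; left; lia.
have aE : dotv (basisv R m j) w = a j.
  rewrite /dotv mxE (bigD1 jo) //= big1 => [|l lj]; rewrite wE !mxE.
    by rewrite /= !eqxx mul1r addr0.
  by rewrite (_ : (l == j :> nat) = false) ?mul0r //; exact: negbTE.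
(* In the last step the list ends whether or not the norm vanishes; that norm couples to row k of
   [B] and is not an entry of the returned matrix. *)
rewrite aE; case: f IHf jf => [|f] IHf jf.
  by case: ifP => _; split=> // -[|i] //= _; rewrite addn0.
have j1m : (j.+1 < m)%N by lia.
have bj : 0 < b j by apply: b_gt0; lia.
have zE : w - a j *: basisv R m j = b j *: basisv R m j.+1.
  apply/colP => i; rewrite mxE wE !mxE.
  have [->|ij] := eqVneq i jo.
    by rewrite /= eqxx mulr1 (_ : (j == j.+1) = false) ?mulr0 ?subrr //; lia.
  rewrite (_ : (i == j :> nat) = false) ?mulr0 ?subr0; last exact: negbTE.
  by case: eqP => [ij1|]; rewrite ?mulr0 // mulr1 (Bo i jo) //; lia.
have bE : enorm (w - a j *: basisv R m j) = b j.
  by rewrite zE enormZ enorm_basisv // mulr1 gtr0_norm.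
rewrite bE gt_eqF // zE scalerA mulVf ?gt_eqF // scale1r.
have [|//|/= sz s1 s2] := IHf j.+1 (basisv R m j) (b j); first by lia.
split=> [|[|i] /=|[|i] /=]; rewrite /= ?sz ?addn0 //.
- by move=> ?; rewrite s1 ?addnS //; lia.
- by move=> ?; rewrite s2 ?addnS //; lia.
Qed.

Lemma exact_lanczos_tridiag (R : realType) (m k : nat) (B : 'M[R]_m)
    (a b : nat -> R) : (0 < m)%N -> (k <= m)%N -> B^T = B -> is_tridiag B ->
  (forall i : 'I_m, (i < k)%N -> B i i = a i) ->
  (forall i j : 'I_m, i = j.+1 :> nat -> (i < k)%N -> B i j = b j) ->
  (forall i, (i.+1 < k)%N -> 0 < b i) ->
  exact_lanczos B (basis1 R m) k =
    existT (fun p : nat => 'M[R]_p) k (symtridiag k a b).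
Proof.
move=> m_gt0 km Bsym Btri Bd Bo b_gt0; rewrite /exact_lanczos.
have -> : basis1 R m = basisv R m 0 by [].
rewrite enorm_basisv // invr1 scale1r.
have [||] := @exact_lanczos_steps_tridiag R m k B a b km Bsym Btri Bd Bo b_gt0
  k 0%N 0 0; rewrite ?scaler0 //.
move: (exact_lanczos_steps _ _ _ _ _) => s <- s1 s2.
congr existT; apply/matrixP => i j; rewrite !mxE.
case: ifP => _; first by rewrite s1.
case: ifP => [/eqP ji|_]; first by rewrite s2 // -ji.
by case: ifP => [/eqP ij|//]; rewrite s2 // -ij.
Qed.

(** * Stacking blocks *)

(** A transport step: the intended order is a product, not syntactically a sum [k.+1 + m]. *)
Lemma tridiag_completion_leq (R : realType) (k N : nat) (leN : (k.+1 <= N)%N)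
    (B : 'M[R]_N) (Q E : 'M[R]_(N, k.+1)) (T : 'M[R]_k.+1) (r : 'cV[R]_N) :
  B^T = B -> T^T = T -> is_tridiag T -> Q^T *m Q = 1%:M -> Q^T *m r = 0 ->
  B *m Q = Q *m T + r *m delta_mx 0 ord_max + E ->
  exists Uh Tt : 'M[R]_N,
    [/\ Uh^T *m Uh = 1%:M, Tt^T = Tt /\ is_tridiag Tt,
        leading_block leN Tt = T, colsub (widen_ord leN) Uh = Q
      & fnorm (Uh^T *m B *m Uh - Tt) <= 2 * fnorm E].
Proof.
move=> Bsym Tsym Ttri QQ Qr BQ.
have [m Nm] : exists m, N = (k.+1 + m)%N.
  by exists (N - k.+1)%N; rewrite subnKC.
subst N; have [W [Tt /= [UU Ttsym Tttri TtT le]]] :=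
  tridiag_completion Bsym Tsym Ttri QQ Qr BQ.
have wl i : widen_ord leN i = lshift m i by apply: val_inj.
exists (row_mx Q W), Tt; split=> //.
  by rewrite -TtT; apply/matrixP => i j; rewrite !mxE !wl.
by apply/matrixP => i j; rewrite mxE wl row_mxEl.
Qed.

Definition stack_mx (R : realType) (k n p : nat) (F : 'I_k -> 'M[R]_(n, p)) :
    'M[R]_(k * n, p) :=
  \matrix_(q, j) F (mxtens_unindex q).1 (mxtens_unindex q).2 j.

Lemma big_mxtens (R : realType) (k n : nat) (F : 'I_(k * n) -> R) :
  \sum_q F q = \sum_i \sum_l F (mxtens_index (i, l)).
Proof.
rewrite pair_bigA /= (reindex (@mxtens_index k n)) /=.
  by apply: eq_bigr => -[].
by exists (@mxtens_unindex k n) => q _; rewrite (mxtens_indexK, mxtens_unindexK).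
Qed.

Lemma tens1mx_stack (R : realType) (k n p : nat) (A : 'M[R]_n)
    (F : 'I_k -> 'M[R]_(n, p)) :
  tensmx (1%:M : 'M[R]_k) A *m stack_mx F = stack_mx (fun i => A *m F i).
Proof.
apply/matrixP => q j; rewrite -[q]mxtens_unindexK; case: mxtens_unindex => i l.
rewrite mxE big_mxtens mxE mxtens_indexK /= (bigD1 i) //= [X in _ + X]big1.
  rewrite addr0 mxE; apply: eq_bigr => l' _.
  by rewrite tensmxE !mxE mxtens_indexK eqxx mul1r.
move=> i' ii'; rewrite big1 // => l' _.
by rewrite tensmxE [1%:M _ _]mxE eq_sym (negbTE ii') !mul0r.
Qed.

Lemma stack_mxM (R : realType) (k n p q : nat) (F : 'I_k -> 'M[R]_(n, p))
    (X : 'M[R]_(p, q)) : stack_mx F *m X = stack_mx (fun i => F i *m X).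
Proof.
by apply/matrixP => i j; rewrite !mxE; apply: eq_bigr => l _; rewrite mxE.
Qed.

Lemma stack_mxD (R : realType) (k n p : nat) (F G : 'I_k -> 'M[R]_(n, p)) :
  stack_mx F + stack_mx G = stack_mx (fun i => F i + G i).
Proof. by apply/matrixP => i j; rewrite !mxE. Qed.

Lemma eq_stack_mx (R : realType) (k n p : nat) (F G : 'I_k -> 'M[R]_(n, p)) :
  F =1 G -> stack_mx F = stack_mx G.
Proof. by move=> FG; apply/matrixP => i j; rewrite !mxE FG. Qed.

Lemma tr_stack_mxM (R : realType) (k n p q : nat) (F : 'I_k -> 'M[R]_(n, p))
    (G : 'I_k -> 'M[R]_(n, q)) :
  (stack_mx F)^T *m stack_mx G = \sum_i (F i)^T *m G i.
Proof.
apply/matrixP => a b; rewrite mxE big_mxtens summxE; apply: eq_bigr => i _.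
by rewrite mxE; apply: eq_bigr => l _; rewrite !mxE mxtens_indexK.
Qed.

Lemma ler_fnorm_stack (R : realType) (k n p : nat) (F : 'I_k -> 'M[R]_(n, p))
    (e : R) : (forall i, fnorm (F i) <= e) -> fnorm (stack_mx F) <= k%:R * e.
Proof.
case: k F => [|k] F Fe.
  by rewrite mul0r fnorm_leP // expr0n big1 // => -[].
have e0 : 0 <= e by apply: le_trans (Fe 0); exact: fnorm_ge0.
rewrite -(@ler_pXn2r _ 2) ?nnegrE ?mulr_ge0 ?fnorm_ge0 //.
rewrite fnorm_sqr_tr tr_stack_mxM [\tr _]raddf_sum /=.
apply: (@le_trans _ _ (\sum_(i < k.+1) e ^+ 2)).
  by apply: ler_sum => i _; rewrite -fnorm_sqr_tr ler_pXn2r ?nnegrE ?fnorm_ge0.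
rewrite sumr_const card_ord -[leLHS]mulr_natl exprMn ler_wpM2r ?sqr_ge0 //.
by rewrite expr2 ler_peMl // ler1n.
Qed.

(** A run of k.+1 steps is encoded with one extra row and column, so that [T] also holds the last
    coefficient beta as [tau]. Cutting [T] to its leading block releases [tau] times the last column
    of the stack, and this is the vector [r]. *)
Lemma lanczos_backward (R : realType) (n k : nat) (leN : (k.+1 <= k.+1 * n)%N)
    (A : 'M[R]_n) (V : 'M[R]_(n, k.+2)) (T : 'M[R]_k.+2) (delta : R) :
  A^T = A -> T^T = T -> is_tridiag T -> 0 <= delta ->
  (forall j : 'I_k.+2, enorm (col j V) = 1) ->
  (forall j : 'I_k.+2, (j < k.+1)%N ->
    enorm (col j (A *m V - V *m T)) <= delta) ->
  (forall i j : 'I_k.+2, j = i.+1 :> nat ->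
    `|T i j * dotv (col i V) (col j V)| <= delta) ->
  exists Uh Tt : 'M[R]_(k.+1 * n),
    [/\ Uh^T *m Uh = 1%:M, Tt^T = Tt /\ is_tridiag Tt,
        leading_block leN Tt = leading_block (leqnSn k.+1) T,
        Uh *m basis1 R (k.+1 * n) = stack_col (fun i : 'I_k.+1 =>
          if i == 0 :> nat then col 0 V else 0)
      & fnorm (Uh^T *m tensmx (1%:M : 'M[R]_k.+1) A *m Uh - Tt) <=
        64 * k.+1%:R ^+ 4 * delta].
Proof.
move=> Asym Tsym Ttri d0 V1 VD TV.
have [Y [Yres YY Y0 Yi0]] := lanczos_isometry Asym Tsym Ttri d0 V1 VD TV.
set L := leadcols R k.+1 in Yres YY.
pose T' := leading_block (leqnSn k.+1) T.
pose tau := T ord_max (widen_ord (leqnSn k.+1) ord_max).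
pose Q := stack_mx (fun i : 'I_k.+1 => Y i *m L).
pose E := stack_mx (fun i : 'I_k.+1 => (A *m Y i - Y i *m T) *m L).
pose r := stack_mx (fun i : 'I_k.+1 => Y i *m (tau *: delta_mx ord_max 0)) : 'cV_ _.
have LL : L^T *m L = 1%:M.
  apply/matrixP => a b; rewrite mulmx_leadcols mxE !mxE eq_sym.
  by rewrite -val_eqE.
have TL : T *m L = L *m T' + tau *: delta_mx ord_max ord_max.
  apply/matrixP => a b; rewrite mulmx_leadcols !mxE.
  have [ak|ka] := ltnP a k.+1.
    have aE : a = widen_ord (leqnSn k.+1) (Ordinal ak) by apply: val_inj.
    rewrite (bigD1 (Ordinal ak)) //= big1 => [|c ca].
      rewrite !mxE -aE eqxx mul1r addr0 (_ : a == ord_max = false) ?mulr0 ?addr0 //.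
      by apply/negP => /eqP /(congr1 val) /=; lia.
    rewrite !mxE (_ : _ == _ = false) ?mul0r //.
    by apply: contra_neqF ca => /eqP /(congr1 val) /= ac; apply: val_inj.
  have -> : a = ord_max by apply: val_inj => /=; have := ltn_ord a; lia.
  rewrite big1 ?add0r => [|c _]; last first.
    rewrite !mxE (_ : _ == _ = false) ?mul0r //.
    by apply/negP => /eqP /(congr1 val) /=; have := ltn_ord c; lia.
  rewrite eqxx /=; case: eqVneq => [->|bmax]; first by rewrite mulr1.
  rewrite mulr0 Ttri //=; apply/orP; right.
  by have := ltn_ord b; move: bmax; rewrite -val_eqE /=; lia.
have [||||||Uh [Tt [UU Ttprop TtT UQ le]]] :=
  @tridiag_completion_leq R k _ leN (tensmx (1%:M : 'M[R]_k.+1) A) Q E T' r.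
- by rewrite trmx_tens trmx1 Asym.
- by apply/matrixP => a b; rewrite !mxE -[in LHS]Tsym mxE.
- by move=> a b ab; rewrite mxE Ttri.
- rewrite /Q tr_stack_mxM.
  under eq_bigr do rewrite trmx_mul -mulmxA (mulmxA (Y _)^T).
  by rewrite -mulmx_sumr -mulmx_suml mulmxA YY LL.
(* The last column of the stack need not be a unit vector, but [YY] gives the first rows of the Gram
   matrix in full, including their zero last entries. *)
- rewrite /Q /r tr_stack_mxM.
  under eq_bigr do rewrite trmx_mul -mulmxA (mulmxA (Y _)^T).
  rewrite -mulmx_sumr -mulmx_suml mulmxA YY -scalemxAr -colE.
  apply/matrixP => a b; rewrite !mxE (_ : _ == _ = false) ?mulr0 //.
  by apply/negP => /eqP /(congr1 val) /=; have := ltn_ord a; lia.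
- rewrite tens1mx_stack /Q /r /E !stack_mxM !stack_mxD; apply: eq_stack_mx => i.
  rewrite -mulmxA -(mulmxA (Y i) (_ *: _)) -scalemxAl mul_delta_mx -mulmxDr -TL.
  by rewrite mulmxBl -!mulmxA addrC subrK.
exists Uh, Tt; split=> //.
- have k0 : (0 < k.+1 * n)%N by exact: leq_trans (ltn0Sn k) leN.
  have -> : Uh *m basis1 R (k.+1 * n) = col 0 Q.
    apply/colP => i; rewrite -UQ !mxE (bigD1 (Ordinal k0)) //= big1.
      rewrite !mxE /= mulr1 addr0; congr (Uh _ _); exact: val_inj.
    by move=> j j0; rewrite mxE (_ : (j == 0 :> nat) = false) ?mulr0 //; exact: negbTE.
  apply/colP => q; rewrite [LHS]mxE [LHS]mxE [RHS]mxE.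
  case: (mxtens_unindex q) => i l /=; rewrite mulmx_leadcols.
  have -> : widen_ord (leqnSn k.+1) 0 = 0 by apply: val_inj.
  case: eqP => [->|/eqP i0].
    by have /colP /(_ l) := Y0; rewrite !mxE.
  by have /colP /(_ l) := Yi0 i ltac:(lia); rewrite !mxE.
- apply: le_trans le _.
  (* There are k.+1 blocks, each with the bound of its residual at the largest index. The completion
     contributes a factor 2 and (k+2)^2 <= 4 (k+1)^2 another 4, whence 64. *)
  have Ele : fnorm E <= k.+1%:R * ((8 * k.+1)%:R * k.+2%:R ^+ 2 * delta).
    apply: ler_fnorm_stack => i; apply: le_trans (Yres i) _.
    rewrite ler_wpM2r // ler_wpM2r ?sqr_ge0 // ler_nat.
    by have := ltn_ord i; lia.
  have K2 : k.+2%:R ^+ 2 <= 4 * k.+1%:R ^+ 2 :> R.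
    rewrite -!natrX -natrM ler_nat; nia.
  apply: (@le_trans _ _ (16 * k.+1%:R ^+ 2 * (k.+2%:R ^+ 2) * delta)).
    by move: Ele; rewrite natrM; set x := k.+1%:R; set y := k.+2%:R; lra.
  rewrite ler_wpM2r //.
  have -> : 64 * k.+1%:R ^+ 4 = 16 * k.+1%:R ^+ 2 * (4 * k.+1%:R ^+ 2) :> R by ring.
  by rewrite ler_wpM2l // mulr_ge0 ?sqr_ge0.
Qed.

(** * Rounding errors of one step *)

Lemma enorm_near1 (R : realType) (n : nat) (v : 'cV[R]_n) (eps : R) :
  0 <= eps <= 1 -> `|dotv v v - 1| <= eps ->
  1 - eps <= enorm v <= 1 + eps.
Proof.
move=> /andP[e0 e1]; rewrite -enorm_sqr ler_norml => /andP[lo hi].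
have := enorm_ge0 v; move: (enorm v) lo hi => x lo hi x0.
by apply/andP; split; nra.
Qed.

Lemma dotvC (R : realType) (n : nat) (x y : 'cV[R]_n) : dotv x y = dotv y x.
Proof. by rewrite /dotv !mxE; apply: eq_bigr => i _; rewrite !mxE mulrC. Qed.

Lemma dotvDr (R : realType) (n : nat) (x y z : 'cV[R]_n) :
  dotv x (y + z) = dotv x y + dotv x z.
Proof. by rewrite /dotv mulmxDr mxE. Qed.

Lemma dotvZr (R : realType) (n : nat) (a : R) (x y : 'cV[R]_n) :
  dotv x (a *: y) = a * dotv x y.
Proof. by rewrite /dotv -scalemxAr mxE. Qed.

Lemma dotvNr (R : realType) (n : nat) (x y : 'cV[R]_n) :
  dotv x (- y) = - dotv x y.
Proof. by rewrite -scaleN1r dotvZr mulN1r. Qed.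

(** The squared norm drops by c^2 (2 - |v|^2), so a roughly normalized v suffices. The triangle
    inequality would only give about 2|w|, and the resulting bound on beta_j would double at every
    step. *)
Lemma enorm_reject (R : realType) (n : nat) (v w : 'cV[R]_n) :
  dotv v v <= 2 -> enorm (w - dotv v w *: v) <= enorm w.
Proof.
move=> v2; rewrite -(@ler_pXn2r _ 2) ?nnegrE ?enorm_ge0 // !enorm_sqr.
set c := dotv v w.
have -> : dotv (w - c *: v) (w - c *: v) = dotv w w - c ^+ 2 * (2 - dotv v v).
  rewrite dotvDr dotvNr dotvZr ![dotv (_ - _) _]dotvC !dotvDr !dotvNr !dotvZr.
  by rewrite [dotv w v]dotvC -/c; ring.
by rewrite lerBlDr lerDl mulr_ge0 ?sqr_ge0 ?subr_ge0.
Qed.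

(** Everything is measured on the scale W = |A| + beta_(j-1). The bound on [z] must have leading
    constant 1, since it feeds the recursion for beta; the other constants are merely generous for
    eps <= 1/20. Local orthogonality holds because v^T z = (1 - v^T v) alpha - e^alpha + v^T e^z
    contains only rounding terms. *)
Lemma fp_lanczos_step (R : realType) (n : nat) (A : 'M[R]_n) (eps : R)
    (vp v u w z : 'cV[R]_n) (bp al : R) (W := specnorm A + bp) :
  0 <= eps -> 20 * eps <= 1 -> 0 <= bp -> enorm vp <= 1 + eps ->
  `|dotv v v - 1| <= eps ->
  (exists2 e : 'cV[R]_n, u = A *m v + e &
     enorm e <= eps * specnorm A * enorm v) ->
  (exists2 e : 'cV[R]_n, w = u - bp *: vp + e &
     enorm e <= eps * (enorm u + bp * enorm vp)) ->
  (exists2 e : R, al = dotv v w + e & `|e| <= eps * enorm v * enorm w) ->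
  (exists2 e : 'cV[R]_n, z = w - al *: v + e &
     enorm e <= eps * (enorm w + `|al| * enorm v)) ->
  [/\ enorm (A *m v - bp *: vp - al *: v - z) <= 5 * (eps * W),
      enorm z <= (1 + 4 * eps) ^+ 2 * W, 3 * `|al| <= 4 * W
    & `|dotv v z| <= 6 * (eps * W)].
Proof.
move=> e0 e20 bp0 vp1 v1 [eu uE eule] [ew wE ewle] [ea aE eale] [ez zE ezle].
have /andP[nv_lo nv_hi] : 1 - eps <= enorm v <= 1 + eps.
  by apply: enorm_near1 => //; lra.
set a := specnorm A in W eule *; have a0 : 0 <= a := specnorm_ge0 A.
have W0 : 0 <= W by rewrite addr_ge0.
have eW0 : 0 <= eps * W by rewrite mulr_ge0.
have nv0 := enorm_ge0 v; have nu0 := enorm_ge0 u; have nw0 := enorm_ge0 w.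
have nAv : enorm (A *m v) <= a * enorm v := ler_enorm_specnorm A v.
have nu : enorm u <= (1 + eps) ^+ 2 * a.
  rewrite uE; apply: le_trans (ler_enormD _ _) _.
  have : a * enorm v <= a * (1 + eps) by rewrite ler_wpM2l.
  by move: nAv eule; set x := a * _; rewrite -mulrA -/x; nra.
have nubp : enorm u + bp * enorm vp <= (1 + eps) ^+ 2 * W.
  have : bp * enorm vp <= bp * (1 + eps) by rewrite ler_wpM2l.
  by rewrite /W; nra.
have nw : enorm w <= (1 + 4 * eps) * W.
  have -> : (1 + 4 * eps) * W = W + 4 * (eps * W) by ring.
  rewrite wE; apply: le_trans (ler_enormD _ _) _.
  have := ler_enormD u (- (bp *: vp)); rewrite enormN enormZ (ger0_norm bp0).
  have : (1 + eps) * (enorm u + bp * enorm vp) <= (1 + 4 * eps) * W.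
    apply: (@le_trans _ _ ((1 + eps) ^+ 3 * W)).
      have -> : (1 + eps) ^+ 3 * W = (1 + eps) * ((1 + eps) ^+ 2 * W) by ring.
      by apply: ler_wpM2l => //; lra.
    by apply: ler_wpM2r => //; nra.
  by lra.
have nw' : 5 * enorm w <= 6 * W by nra.
have nal : `|al| <= (1 + eps) * (enorm v * enorm w).
  rewrite aE; apply: le_trans (ler_normD _ _) _.
  by have := ler_dotv v w; move: eale; rewrite -mulrA; lra.
have nvw : enorm v * enorm w <= (1 + eps) * enorm w by rewrite ler_wpM2r.
have nal' : `|al| <= (1 + eps) ^+ 2 * enorm w by nra.
have al43 : 3 * `|al| <= 4 * W by nra.
have al0 : 0 <= `|al| := normr_ge0 al.
have alv : `|al| * enorm v <= (1 + eps) * `|al| by rewrite mulrC ler_wpM2r.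
have alw : 100 * `|al| <= 111 * enorm w.
  have e2 : 100 * (1 + eps) ^+ 2 <= 111 by clear -e0 e20; nra.
  by have := ler_wpM2r nw0 e2; lra.
have alv' : 20 * (`|al| * enorm v) <= 21 * `|al|.
  by have : 20 * eps * `|al| <= 1 * `|al|; [rewrite ler_wpM2r | lra].
have nez : enorm ez <= 27 / 10 * (eps * W).
  apply: le_trans ezle _; rewrite [leRHS]mulrCA ler_wpM2l //; lra.
have nea : `|ea| <= 13 / 10 * (eps * W).
  apply: le_trans eale _; rewrite -mulrA [leRHS]mulrCA ler_wpM2l //; nra.
split=> //.
- have -> : A *m v - bp *: vp - al *: v - z = - (eu + (ew + ez)).
    by rewrite zE wE uE; apply/matrixP => i j; rewrite !mxE; ring.
  rewrite enormN; apply: le_trans (ler_enormD _ _) _.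
  have := ler_enormD ew ez.
  have : enorm eu <= 11 / 10 * (eps * W).
    apply: le_trans eule _; rewrite -mulrA [leRHS]mulrCA ler_wpM2l //.
    by rewrite /W; nra.
  have : enorm ew <= 12 / 10 * (eps * W).
    apply: le_trans ewle _; rewrite [leRHS]mulrCA ler_wpM2l //; nra.
  by lra.
- have -> : z = (w - dotv v w *: v) + (ez - ea *: v).
    by rewrite zE aE; apply/matrixP => i j; rewrite !mxE; ring.
  apply: le_trans (ler_enormD _ _) _.
  have v2 : dotv v v <= 2 by move: v1; rewrite ler_norml => /andP[_]; lra.
  have := enorm_reject w v2; have := ler_enormD ez (- (ea *: v)).
  rewrite enormN enormZ.
  have ez' : enorm ez <= 26 / 10 * (eps * enorm w).
    apply: le_trans ezle _; rewrite [leRHS]mulrCA ler_wpM2l //; lra.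
  have ea' : `|ea| * enorm v <= 13 / 10 * (eps * enorm w).
    apply: (@le_trans _ _ (eps * enorm v * enorm w * enorm v)).
      by rewrite ler_wpM2r.
    have -> : eps * enorm v * enorm w * enorm v =
      enorm v ^+ 2 * (eps * enorm w) by ring.
    rewrite ler_wpM2r ?mulr_ge0 //; nra.
  have : (1 + 4 * eps) * enorm w <= (1 + 4 * eps) ^+ 2 * W.
    by rewrite expr2 -mulrA ler_wpM2l //; lra.
  have : 0 <= eps * enorm w by rewrite mulr_ge0.
  by lra.
- have -> : dotv v z = (1 - dotv v v) * al - ea + dotv v ez.
    by rewrite zE !dotvDr dotvNr dotvZr aE; ring.
  have h1 : `|(1 - dotv v v) * al| <= 4 / 3 * (eps * W).
    rewrite normrM distrC; apply: (@le_trans _ _ (eps * `|al|)).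
      by rewrite ler_wpM2r.
    by rewrite [leRHS]mulrCA ler_wpM2l //; lra.
  have h2 : `|dotv v ez| <= 3 * (eps * W).
    by apply: le_trans (ler_dotv _ _) _; have := enorm_ge0 ez; nra.
  have := ler_normD ((1 - dotv v v) * al - ea) (dotv v ez).
  have := ler_normB ((1 - dotv v v) * al) ea.
  by lra.
Qed.

(** For eps <= 1/20 the constant 12 absorbs (1 + eps)(1 + 4 eps)^2 / (1 - eps). *)
Lemma fp_lanczos_normalize (R : realType) (n : nat) (z vn : 'cV[R]_n)
    (b eps W : R) :
  0 <= eps -> 20 * eps <= 1 -> 0 <= b -> 0 <= W -> `|dotv vn vn - 1| <= eps ->
  enorm z <= (1 + 4 * eps) ^+ 2 * W -> enorm (b *: vn - z) <= eps * enorm z ->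
  b <= (1 + 12 * eps) * W.
Proof.
move=> e0 e20 b0 W0 vn1 zW Dz.
have /andP[lo hi] : 1 - eps <= enorm vn <= 1 + eps.
  by apply: enorm_near1 => //; lra.
have bvn : b * enorm vn <= (1 + eps) * enorm z.
  rewrite -[X in X * _](ger0_norm b0) -enormZ -(subrK z (b *: vn)).
  by apply: le_trans (ler_enormD _ _) _; lra.
have : (1 - eps) * b <= (1 - eps) * ((1 + 12 * eps) * W).
  apply: (@le_trans _ _ (b * enorm vn)); first by rewrite mulrC ler_wpM2l.
  apply: le_trans bvn _; apply: (@le_trans _ _ ((1 + eps) * ((1 + 4 * eps) ^+ 2 * W))).
    by rewrite ler_wpM2l //; lra.
  by rewrite !mulrA ler_wpM2r //; nra.
by rewrite ler_pM2l //; lra.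
Qed.

(** * The whole run *)

Lemma sum_ord_eqr (R : realType) (n m : nat) (F : nat -> R) :
  (m < n)%N -> \sum_(i < n) F i * (i == m :> nat)%:R = F m.
Proof.
move=> mn; rewrite (bigD1 (Ordinal mn)) //= eqxx mulr1 big1 ?addr0 // => i im.
by rewrite (_ : (i == m :> nat) = false) ?mulr0 //; exact: negbTE.
Qed.

Lemma symtridiag_tr (R : realType) (m : nat) (a b : nat -> R) :
  (symtridiag m a b)^T = symtridiag m a b.
Proof.
apply/matrixP => i j; rewrite !mxE eq_sym; case: eqVneq => [->//|_].
by case: eqP => [ij|_]; case: eqP => [ji|_] //; lia.
Qed.

Lemma symtridiag_tridiag (R : realType) (m : nat) (a b : nat -> R) :
  is_tridiag (symtridiag m a b).
Proof.
move=> i j ij; rewrite mxE; case: eqVneq ij => [->|_ ij]; first by lia.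
by do 2!(case: eqP; first by lia).
Qed.

Lemma col_symtridiag (R : realType) (n m : nat) (y : nat -> 'cV[R]_n)
    (a b : nat -> R) (j : 'I_m) : (j.+1 < m)%N ->
  col j ((\matrix_(l, i) y i l 0) *m symtridiag m a b) =
  (if nat_of_ord j is j'.+1 then b j' *: y j' else 0) + a j *: y j + b j *: y j.+1.
Proof.
move=> jm; apply/colP => l; rewrite !mxE.
have TE (i : 'I_m) : symtridiag m a b i j =
    (if nat_of_ord j is j'.+1 then b i * (i == j' :> nat)%:R else 0) +
    a i * (i == j :> nat)%:R + b j * (i == j.+1 :> nat)%:R.
  rewrite mxE (_ : (i == j) = (i == j :> nat)) //.
  move: (nat_of_ord i) (nat_of_ord j) => {}i [|j'].
    by case: i => [|[|i']] /=; ring.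
  have [->|ij] := eqVneq i j'.+1.
    by rewrite (gtn_eqF (ltnSn j')) (ltn_eqF (ltnSn j'.+1)) /=; ring.
  rewrite eqSS [j' == _]eq_sym; have [->|ij'] := eqVneq i j'.
    by rewrite (ltn_eqF (ltnW (ltnSn j'.+1))) /=; ring.
  by case: eqP => _ /=; ring.
under eq_bigr do rewrite TE mxE !mulrDr [y _ _ _ * (a _ * _)]mulrA
  [y _ _ _ * (b _ * _)]mulrA.
rewrite !big_split /= (sum_ord_eqr (fun i => y i l 0 * a i)) ?ltn_ord //.
rewrite (sum_ord_eqr (fun i => y i l 0 * b j)) //.
congr (_ + _ + _); last 2 first.
- by rewrite mulrC.
- by rewrite mulrC.
have: (j < m)%N by []; case: (nat_of_ord j) => [|j'] j'm.
  by rewrite big1 ?mxE // => i _; rewrite mulr0.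
under eq_bigr do rewrite mulrA.
by rewrite (sum_ord_eqr (fun i => y i l 0 * b i)) ?mxE 1?mulrC //; lia.
Qed.

Lemma enorm_normalize (R : realType) (n : nat) (x : 'cV[R]_n) :
  0 < enorm x -> enorm ((enorm x)^-1 *: x) = 1.
Proof. by move=> x0; rewrite enormZ gtr0_norm ?invr_gt0 // mulVf ?gt_eqF. Qed.

Lemma enorm_normalize_sub (R : realType) (n : nat) (x : 'cV[R]_n) (eps : R) :
  0 < enorm x -> 1 - eps <= enorm x <= 1 + eps ->
  enorm ((enorm x)^-1 *: x - x) <= eps.
Proof.
move=> x0 xe; rewrite -[X in _ - X]scale1r -scalerBl enormZ.
rewrite -[X in _ * X]gtr0_norm // -normrM mulrBl mul1r mulVf ?gt_eqF //.
by rewrite ler_norml; lra.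
Qed.

(* When the run breaks down at step k, v k.+1 is replaced by v 1: it only
   enters multiplied by beta k = 0. *)
Lemma fp_lanczos_run_bounds (R : realType) (n : nat) (A : 'M[R]_n)
    (x : 'cV[R]_n) (eps : R) (k : nat) (v u w z : nat -> 'cV[R]_n)
    (alpha beta : nat -> R) (a := specnorm A) (kk := k%:R : R) :
  (0 < k)%N -> 0 <= eps -> 20 * (eps * kk) <= 1 ->
  fp_lanczos_run A x eps k v u w z alpha beta ->
  exists y : nat -> 'cV[R]_n,
    [/\ y 1%N = (enorm (v 1%N))^-1 *: v 1%N,
        forall j, (1 <= j <= k.+1)%N -> enorm (y j) = 1,
        forall j, (1 <= j <= k)%N ->
          enorm (A *m y j - (if j is j'.+2 then beta j'.+1 *: y j'.+1 else 0)
                 - alpha j *: y j - beta j *: y j.+1) <= 32 * (eps * kk * a)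
      & forall j, (1 <= j <= k)%N ->
          `|beta j * dotv (y j) (y j.+1)| <= 32 * (eps * kk * a)].
Proof.
move=> k_gt0 e0 ek [v0 b0 v1 _ ru rw ra rz rnext rstop rnostop].
have kk1 : 1 <= kk by rewrite ler1n.
have a0 : 0 <= a := specnorm_ge0 A.
have e20 : 20 * eps <= 1.
  by have : eps * 1 <= eps * kk; [rewrite ler_wpM2l | lra].
pose vv j := if (j == k.+1) && (z k == 0) then v 1%N else v j.
have vvE j : (j <= k)%N -> vv j = v j.
  by move=> jk; rewrite /vv (_ : (j == k.+1) = false) //; lia.
have vv1 j : (1 <= j <= k.+1)%N -> `|dotv (vv j) (vv j) - 1| <= eps.
  rewrite /vv; case: eqVneq => [->|jk] /= jb.
    case: ifP => // /negbT zk; have [|//|_ _] := rnext k; by rewrite ?k_gt0 /=.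
  case: j jb jk => [|[|j]] // jb jk.
  have jk1 : (1 <= j.+1 <= k)%N by lia.
  by have [|_ _] := rnext j.+1 jk1; [apply: rnostop; lia | ].
have b_ge0 j : (j <= k)%N -> 0 <= beta j.
  case: j => [|j] jk; first by rewrite b0.
  have [zj|zj] := eqVneq (z j.+1) 0; first by rewrite rstop.
  by have [||/ltW] := rnext j.+1.
have bvv j : (1 <= j <= k)%N ->
    enorm (beta j *: vv j.+1 - z j) <= eps * enorm (z j).
  move=> jk; have [zj|zj] := eqVneq (z j) 0.
    by rewrite rstop // zj scale0r subr0 -!fnorm_cV fnorm0 mulr0.
  have [//|//|_ [D bD Dle] _] := rnext j.
  rewrite /vv (_ : _ && _ = false); first by rewrite bD addrC addKr.
  by apply/negP => /andP[/eqP [jE]]; rewrite -jE (negbTE zj).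
have vv_near j : (1 <= j <= k.+1)%N -> 1 - eps <= enorm (vv j) <= 1 + eps.
  by move=> jk; apply: enorm_near1 (vv1 _ jk); lra.
have vvp j : (j <= k)%N -> enorm (vv j) <= 1 + eps.
  case: j => [|j] jk; last by have /andP[] := vv_near j.+1 ltac:(lia).
  by rewrite vvE // v0 -fnorm_cV fnorm0; lra.
have step j (jk : (1 <= j <= k)%N) :
  [/\ enorm (A *m vv j - beta j.-1 *: vv j.-1 - alpha j *: vv j - z j) <=
        5 * (eps * (a + beta j.-1)),
      enorm (z j) <= (1 + 4 * eps) ^+ 2 * (a + beta j.-1),
      3 * `|alpha j| <= 4 * (a + beta j.-1)
    & `|dotv (vv j) (z j)| <= 6 * (eps * (a + beta j.-1))].
  have jk' : (j <= k)%N by lia.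
  have jk'' : (j.-1 <= k)%N by lia.
  have vj := vvE _ jk'; have vj' := vvE _ jk''.
  apply: (@fp_lanczos_step R n A eps (vv j.-1) (vv j) (u j) (w j) (z j)
    (beta j.-1) (alpha j)) => //.
  - exact: b_ge0.
  - exact: vvp.
  - by apply: vv1; lia.
  - by rewrite vj; exact: ru.
  - by rewrite vj'; exact: rw.
  - by rewrite vj; exact: ra.
  - by rewrite vj; exact: rz.
(* The recursion beta_j <= (1 + 12 eps)(|A| + beta_(j-1)) stays linear in j thanks to 20 eps k <= 1,
   which gives (1 + 12 eps)(1 + 3 t) <= 3 (t + 1) for t + 1 <= k. *)
have b_le j : (j <= k)%N -> beta j <= 3 * (j%:R * a).
  elim: j => [|j IHj] jk; first by rewrite b0 mul0r mulr0.
  have [_ zle _ _] := step j.+1 jk.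
  have bj0 : 0 <= beta j by apply/b_ge0/ltnW.
  have := fp_lanczos_normalize e0 e20 (b_ge0 _ jk) (addr_ge0 a0 bj0)
    (vv1 j.+2 jk) zle (bvv j.+1 jk).
  have := IHj (ltnW jk); rewrite /= -[j.+1]addn1 natrD.
  have : j%:R + 1 <= kk by rewrite natr1 ler_nat.
  have : 0 <= j%:R :> R by [].
  move: (beta j) (beta (j + 1)) bj0 (j%:R) => bp b bp0 t t0 tk IH le_b.
  apply: le_trans le_b _.
  have et : 20 * (eps * (t + 1)) <= 1.
    by have : eps * (t + 1) <= eps * kk; [rewrite ler_wpM2l | lra].
  apply: (@le_trans _ _ ((1 + 12 * eps) * ((1 + 3 * t) * a))).
    by apply: ler_wpM2l; lra.
  by rewrite !mulrA ler_wpM2r //; lra.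
pose B := kk * a; have B0 : 0 <= B by rewrite mulr_ge0 // (le_trans _ kk1).
have aB : a <= B by rewrite ler_peMl.
have bB j : (j <= k)%N -> beta j <= 3 * B.
  move=> jk; apply: le_trans (b_le _ jk) _.
  by rewrite ler_wpM2l // ler_wpM2r // ler_nat.
have WB j : (1 <= j <= k)%N -> a + beta j.-1 <= 3 * B.
  case: j => // j jk; have := b_le j (ltnW jk).
  have : (j%:R + 1) * a <= B by rewrite ler_wpM2r // natr1 ler_nat.
  by rewrite /=; lra.
have vpos j : (1 <= j <= k.+1)%N -> 0 < enorm (vv j).
  by move=> /vv_near /andP[]; lra.
(* Exact normalization makes the diagonal of the Gram matrix equal to 1; it moves each vector by at
   most eps. *)
pose y j := (enorm (vv j))^-1 *: vv j.
have yv j : (1 <= j <= k.+1)%N -> enorm (y j - vv j) <= eps.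
  by move=> jk; apply: enorm_normalize_sub; [exact: vpos | exact: vv_near].
have eB0 : 0 <= eps * B by rewrite mulr_ge0.
have zB j : (1 <= j <= k)%N -> enorm (z j) <= 5 * B.
  move=> jk; have [_ zle _ _] := step j jk; apply: le_trans zle _.
  apply: (@le_trans _ _ ((1 + 4 * eps) ^+ 2 * (3 * B))).
    by rewrite ler_wpM2l ?sqr_ge0 ?WB.
  by rewrite mulrA ler_wpM2r //; clear -e0 e20; nra.
have -> : eps * kk * a = eps * B by rewrite mulrA.
exists y; split=> [|j jk|j jk|j jk].
- by rewrite /y vvE.
- exact/enorm_normalize/vpos.
- have [Fle _ al_le _] := step j jk.
  have [j1 j2 jk'] : [/\ 1 <= j <= k.+1, 1 <= j.+1 <= k.+1 & j <= k]%N.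
    by clear -jk; split; lia.
  (* The residual at the computed vectors, plus each coefficient times a displacement of size eps.
     The six bounds below add up to 15 + 5 + 1 + 3 + 4 + 3 = 31. *)
  have -> : A *m y j - (if j is j'.+2 then beta j'.+1 *: y j'.+1 else 0)
      - alpha j *: y j - beta j *: y j.+1 =
    (A *m vv j - beta j.-1 *: vv j.-1 - alpha j *: vv j - z j)
    - (beta j *: vv j.+1 - z j) + A *m (y j - vv j)
    - (if j is j'.+2 then beta j'.+1 *: (y j'.+1 - vv j'.+1) else 0)
    - alpha j *: (y j - vv j) - beta j *: (y j.+1 - vv j.+1).
    rewrite mulmxBr; have -> : beta j.-1 *: vv j.-1 =
        if j is j'.+2 then beta j'.+1 *: vv j'.+1 else 0.
      by case: (j) => [|[|j']] //=; rewrite b0 scale0r.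
    move: (A *m y j) (A *m vv j) => Ay Av.
    by case: (j) => [|[|j']]; apply/matrixP => p q; rewrite !mxE; ring.
  have h1 : 5 * (eps * (a + beta j.-1)) <= 15 * (eps * B).
    by have : eps * (a + beta j.-1) <= eps * (3 * B);
      [rewrite ler_wpM2l ?WB | lra].
  have h2 : enorm (beta j *: vv j.+1 - z j) <= 5 * (eps * B).
    by apply: le_trans (bvv _ jk) _; rewrite [leRHS]mulrCA ler_wpM2l ?zB.
  have h3 : enorm (A *m (y j - vv j)) <= eps * B.
    apply: le_trans (ler_enorm_specnorm _ _) _; rewrite mulrC.
    by rewrite ler_pM ?enorm_ge0 ?yv.
  have h4 : enorm (if j is j'.+2 then beta j'.+1 *: (y j'.+1 - vv j'.+1) else 0)
      <= 3 * (eps * B).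
    case: (j) jk => [|[|j']] j'k; try by rewrite -fnorm_cV fnorm0 mulr_ge0.
    have [j3 j4] : [/\ j'.+1 <= k & 1 <= j'.+1 <= k.+1]%N.
      by clear -j'k; split; lia.
    by rewrite enormZ ger0_norm ?b_ge0 // [leRHS]mulrCA mulrC ler_pM
      ?enorm_ge0 ?yv ?bB ?b_ge0.
  have h5 : enorm (alpha j *: (y j - vv j)) <= 4 * (eps * B).
    rewrite enormZ [leRHS]mulrCA mulrC ler_pM ?enorm_ge0 ?yv //.
    by have := WB j jk; lra.
  have h6 : enorm (beta j *: (y j.+1 - vv j.+1)) <= 3 * (eps * B).
    rewrite enormZ ger0_norm ?b_ge0 // [leRHS]mulrCA mulrC.
    by rewrite ler_pM ?enorm_ge0 ?yv ?bB ?b_ge0.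
  have leD (p q : 'cV[R]_n) c d :
      enorm p <= c -> enorm q <= d -> enorm (p + q) <= c + d.
    by move=> pc qd; apply: le_trans (ler_enormD _ _) (lerD pc qd).
  have leB (p q : 'cV[R]_n) c d :
      enorm p <= c -> enorm q <= d -> enorm (p - q) <= c + d.
    by move=> pc qd; apply: leD => //; rewrite enormN.
  apply: le_trans (leB _ _ _ _ (leB _ _ _ _ (leB _ _ _ _ (leD _ _ _ _
    (leB _ _ _ _ (le_trans Fle h1) h2) h3) h4) h5) h6) _; lra.
- have [_ _ _ dot_le] := step j jk.
  have [j1 j2 jk'] : [/\ 1 <= j <= k.+1, 1 <= j.+1 <= k.+1 & j <= k]%N.
    by clear -jk; split; lia.
  have /andP[lo1 hi1] := vv_near j j1; have /andP[lo2 hi2] := vv_near _ j2.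
  set X := `|_|.
  have XE : X * (enorm (vv j) * enorm (vv j.+1)) =
      `|dotv (vv j) (z j + (beta j *: vv j.+1 - z j))|.
    rewrite addrC subrK dotvZr /X /y dotvZr dotvC dotvZr dotvC !normrM.
    rewrite !normrV ?unitfE ?gt_eqF ?vpos // (ger0_norm (b_ge0 _ jk')).
    rewrite !(ger0_norm (enorm_ge0 _)).
    by field; rewrite !gt_eqF ?vpos.
  (* Rounding in v^T z gives 6 * 3 and the normalization error 21/4, together below 24; dividing by
     the two norms, each at least 19/20, stays below 32. *)
  have h : X * (enorm (vv j) * enorm (vv j.+1)) <= 24 * (eps * B).
    rewrite XE dotvDr; apply: le_trans (ler_normD _ _) _.
    have := ler_dotv (vv j) (beta j *: vv j.+1 - z j).
    have h1 : eps * (a + beta j.-1) <= eps * (3 * B) by rewrite ler_wpM2l ?WB.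
    have h2 : enorm (beta j *: vv j.+1 - z j) <= 5 * (eps * B).
      by apply: le_trans (bvv _ jk) _; rewrite [leRHS]mulrCA ler_wpM2l ?zB.
    have h3 : enorm (vv j) * enorm (beta j *: vv j.+1 - z j) <=
        21 / 20 * (5 * (eps * B)).
      by apply: ler_pM h2; rewrite ?enorm_ge0 //; lra.
    by lra.
  have h4 : 19 / 20 * (19 / 20) <= enorm (vv j) * enorm (vv j.+1).
    by clear -e20 lo1 lo2; apply: ler_pM => //; lra.
  have X0 : 0 <= X := normr_ge0 _.
  by have := ler_wpM2l X0 h4; lra.
Qed.

Theorem theorem4p6 (R : realType) :
  exists c d : R, [/\ 0 < c, 0 < d &
    forall (n k kmax : nat) (A : 'M[R]_n) (x : 'cV[R]_n) (eps : R)
      (v u w z : nat -> 'cV[R]_n) (alpha beta : nat -> R)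
      (n_gt0 : (0 < n)%N),
    (1 <= k <= kmax)%N ->
    A^T = A -> x != 0 ->
    0 <= eps <= (20 * kmax%:R)^-1 ->
    fp_lanczos_run A x eps k v u w z alpha beta ->
    let Tk : 'M[R]_k :=
      symtridiag k (fun i => alpha i.+1) (fun i => beta i.+1) in
    exists S Tt : 'M[R]_(k * n),
      [/\ S^T = S /\ Tt^T = Tt,
          is_tridiag Tt /\ leading_block (leq_pmulr k n_gt0) Tt = Tk,
          exists Uh : 'M[R]_(k * n),
            [/\ Uh^T *m Uh = 1%:M,
                S = Uh^T *m tensmx (1%:M : 'M[R]_k) A *m Uh
              & Uh *m basis1 R (k * n) =
                stack_col (fun i : 'I_k =>
                  if i == 0 :> nat then (enorm (v 1%N))^-1 *: v 1%N else 0)],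
          specnorm (S - Tt) <= c * k%:R `^ d * eps * specnorm A
        & exact_lanczos Tt (basis1 R (k * n)) k =
          existT (fun p : nat => 'M[R]_p) k Tk]].

Proof.
(* 2048 = 64 * 32, and the exponent is 4 + 1. *)
exists 2048, 5; split=> // n k kmax A x eps v u w z alpha beta n_gt0.
case: k => // k kkmax Asym x_neq0 /andP[e0 ekmax] run Tk.
have ek : 20 * (eps * k.+1%:R) <= 1.
  have kmax_gt0 : 0 < kmax%:R :> R by rewrite ltr0n; lia.
  have ek : eps * (20 * kmax%:R) <= 1.
    by rewrite -ler_pdivlMr ?mulr_gt0 // div1r.
  have : eps * k.+1%:R <= eps * kmax%:R by rewrite ler_wpM2l // ler_nat; lia.
  by lra.
have [y [y1 yunit yres ylocal]] := fp_lanczos_run_bounds (ltn0Sn k) e0 ek run.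
pose V : 'M[R]_(n, k.+2) := \matrix_(l, i) y i.+1 l 0.
(* The order exceeds that of [Tk] by one so that [beta k.+1], zero on breakdown, is included; the
   corner entry [alpha k.+2] lies beyond the run and falls in the column that [leadcols] cuts
   off. *)
pose T := symtridiag k.+2 (fun i => alpha i.+1) (fun i => beta i.+1).
have colV j : col j V = y j.+1 by apply/colP => l; rewrite !mxE.
have TTk : leading_block (leqnSn k.+1) T = Tk.
  by apply/matrixP => i j; rewrite !mxE.
set delta := 32 * (eps * k.+1%:R * specnorm A) in yres ylocal.
have d0 : 0 <= delta by rewrite !mulr_ge0 // specnorm_ge0.
have V1 j : enorm (col j V) = 1.
  by rewrite colV yunit //; have := ltn_ord j; lia.
have VD (j : 'I_k.+2) : (j < k.+1)%N ->
    enorm (col j (A *m V - V *m T)) <= delta.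
  move=> jk; have := yres j.+1 jk.
  suff -> : col j (A *m V - V *m T) = A *m y j.+1
      - (if j.+1 is j'.+2 then beta j'.+1 *: y j'.+1 else 0)
      - alpha j.+1 *: y j.+1 - beta j.+1 *: y j.+2 by [].
  rewrite raddfB /= (col_symtridiag (fun i => y i.+1)) //.
  rewrite colE -mulmxA -colE colV.
  by case: (nat_of_ord j) => [|j'] /=; rewrite !opprD !addrA.
have TV (i j : 'I_k.+2) : j = i.+1 :> nat ->
    `|T i j * dotv (col i V) (col j V)| <= delta.
  move=> ij; rewrite !colV mxE (_ : (i == j) = false); last first.
    by apply/negP => /eqP ijE; move: ij; rewrite ijE; lia.
  by rewrite ij eqxx ylocal //; have := ltn_ord j; lia.
have [Uh [Tt [UU [Ttsym Tttri] TtT Ue1 le]]] := lanczos_backward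
  (leq_pmulr k.+1 n_gt0) Asym (symtridiag_tr _ _ _)
  (@symtridiag_tridiag _ _ _ _) d0 V1 VD TV.
rewrite TTk in TtT.
exists (Uh^T *m tensmx (1%:M : 'M[R]_k.+1) A *m Uh), Tt; split=> //.
- by rewrite !trmx_mul trmxK trmx_tens trmx1 Asym mulmxA.
- exists Uh; split=> //; rewrite Ue1 colV y1.
  by congr stack_col.
- apply: le_trans (specnorm_le_fnorm _) _; apply: le_trans le _.
  rewrite powR_mulrn // /delta le_eqVlt; apply/orP; left; apply/eqP; ring.
- have TtE (i j : 'I_k.+1) : Tt (widen_ord (leq_pmulr k.+1 n_gt0) i)
      (widen_ord (leq_pmulr k.+1 n_gt0) j) = Tk i j by rewrite -TtT mxE.
  apply: exact_lanczos_tridiag => //; first by rewrite muln_gt0.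
  + exact: leq_pmulr.
  + move=> i ik; have -> : i = widen_ord (leq_pmulr k.+1 n_gt0) (Ordinal ik).
      exact: val_inj.
    by rewrite TtE mxE eqxx.
  + move=> i j ij ik; have jk : (j < k.+1)%N by lia.
    have -> : i = widen_ord (leq_pmulr k.+1 n_gt0) (Ordinal ik) by exact: val_inj.
    have jE : j = widen_ord (leq_pmulr k.+1 n_gt0) (Ordinal jk) by exact: val_inj.
    rewrite [in LHS]jE TtE mxE -val_eqE /= ij.
    by rewrite (gtn_eqF (ltnSn j)) (ltn_eqF (ltnW (ltnSn j.+1))) eqxx.
  + move=> i ik; have ik' : (1 <= i.+1 <= k.+1)%N by lia.
    by have [|//] := fp_next run ik'; apply: (fp_no_early_stop run); lia.
Qed.
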